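(* Let $n>1$ be an odd integer and let $M$ be either $(n+1)/2$ or $n-1$. Then, modulo $[n]\Phi_n(q)^3$, \begin{align*} &\sum_{k=0}^{M}[4k-1]\frac{(q^{-1};q^2)_k^4(cq^{-1},dq^{-1};q^2)_k}{(q^2;q^2)_k^4(q^2/c,q^2/d;q^2)_k}\bigg(\frac{q^7}{cd}\bigg)^k\\ &\equiv\frac{\Omega_q(n)(1-q)^2(q^3/cd;q^2)_2}{(1+q)^2(q^2/c,q^2/d;q^2)_2} \sum_{k=0}^{(n-3)/2}\frac{(q^3;q^2)_k^3(q^7/cd;q^2)_k}{(q^2,q^6,q^6/c,q^6/d;q^2)_k}q^{2k}, \end{align*} where \[ \Omega_q(n)=[n]^3\bigg\{\frac{n^2(1-q)^2-(1+22q+q^2)}{24}-\frac{1}{q[n]^2[n-1][n+1]}\bigg\}\frac{q^{(n+5)/2}}{1+q^2}. \]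
   Context: Here $q,c,d$ are indeterminates. The $q$-shifted factorial is $(x;q)_0=1$, $(x;q)_k=(1-x)(1-xq)\cdots(1-xq^{k-1})$ for $k\ge1$, and $(x_1,\dots,x_m;q)_k=(x_1;q)_k\cdots(x_m;q)_k$. The $q$-integer is $[m]=(1-q^m)/(1-q)$, and $\Phi_n(q)$ is the $n$-th cyclotomic polynomial in $q$. A congruence $A\equiv B$ modulo a polynomial $P$ between rational functions means that $A-B$ is a rational function whose numerator is divisible by $P$ and whose denominator is coprime to $P$. *)

(* Defs.v *)
From HB Require Import structures.
From mathcomp Require Import all_boot all_order all_algebra all_field.
Set Implicit Arguments. Unset Strict Implicit. Unset Printing Implicit Defensive.
Import Order.TTheory GRing.Theory Num.Theory.
Local Open Scope ring_scope.

(* Polynomial ring Q[q,c,d] realised as nested univariate polynomials: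
   d is the outermost variable, c the middle one, q the innermost. *)
Definition R3 := {poly {poly {poly rat}}}.
Definition qR : R3 := ('X)%:P%:P.
Definition cR : R3 := ('X)%:P.
Definition dR : R3 := 'X.

Definition F3 := {fraction R3}.
Definition toF (x : R3) : F3 := @FracField.tofrac R3 x.
Definition q : F3 := toF qR.
Definition c : F3 := toF cR.
Definition d : F3 := toF dR.

Definition qpoch (x p : F3) (k : nat) : F3 := \prod_(i < k) (1 - x * p ^+ i).

Definition qint (m : int) : F3 := (1 - q ^ m) / (1 - q).

Definition PhiR (n : nat) : R3 := (map_poly (fun z : int => z%:~R) 'Phi_n).[qR].

Definition qintR (n : nat) : R3 := \sum_(i < n) qR ^+ i.

Definition rdiv (a b : R3) : Prop := exists k : R3, b = a * k.

Definition congr_mod (A B : F3) (P : R3) : Prop :=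
  exists N D : R3, D != 0 /\ A - B = toF N / toF D /\ rdiv P N /\
    (forall g : R3, rdiv g D -> rdiv g P -> g \is a GRing.unit).

Definition Omega (n : nat) : F3 :=
  qint n ^+ 3 *
  (((n ^ 2)%:R * (1 - q) ^+ 2 - (1 + 22%:R * q + q ^+ 2)) / 24%:R
     - 1 / (q * qint n ^+ 2 * qint (n.-1)%:Z * qint n.+1))
  * q ^+ ((n + 5)./2) / (1 + q ^+ 2).

Definition lhs12 (M : nat) : F3 :=
  \sum_(0 <= k < M.+1)
    qint ((4 * k)%:Z - 1) *
    (qpoch (q^-1) (q ^+ 2) k ^+ 4 * qpoch (c / q) (q ^+ 2) k * qpoch (d / q) (q ^+ 2) k)
    / (qpoch (q ^+ 2) (q ^+ 2) k ^+ 4 * qpoch (q ^+ 2 / c) (q ^+ 2) k * qpoch (q ^+ 2 / d) (q ^+ 2) k)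
    * (q ^+ 7 / (c * d)) ^+ k.

Definition rhs12 (n : nat) : F3 :=
  Omega n * (1 - q) ^+ 2 * qpoch (q ^+ 3 / (c * d)) (q ^+ 2) 2
    / ((1 + q) ^+ 2 * qpoch (q ^+ 2 / c) (q ^+ 2) 2 * qpoch (q ^+ 2 / d) (q ^+ 2) 2)
  * \sum_(0 <= k < ((n - 3) %/ 2).+1)
      qpoch (q ^+ 3) (q ^+ 2) k ^+ 3 * qpoch (q ^+ 7 / (c * d)) (q ^+ 2) k
      / (qpoch (q ^+ 2) (q ^+ 2) k * qpoch (q ^+ 6) (q ^+ 2) k
         * qpoch (q ^+ 6 / c) (q ^+ 2) k * qpoch (q ^+ 6 / d) (q ^+ 2) k)
      * q ^+ (2 * k).

(* Main.v *)
Require Import Defs.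
From HB Require Import structures.
From mathcomp Require Import all_boot all_order all_algebra all_field.
From mathcomp Require Import ring zify.
Set Implicit Arguments. Unset Strict Implicit. Unset Printing Implicit Defensive.
Import Order.TTheory GRing.Theory Num.Theory.
Local Open Scope ring_scope.

(* Write u = q^n, N = (n+1)/2, w = (1-u)^2/u, and let S(a,b) be the left-hand sum
   with three of its pairs (q^-1;q^2)_k/(q^2;q^2)_k deformed to
   (a/q)_k/(q^2/a)_k, (1/aq)_k/(aq^2)_k and (b/q)_k/(q^2/b)_k.  It depends on a
   only through a + 1/a - 2, which is 0 at a = 1 and w at a = u.  Modulo Phi_n the
   summand is antisymmetric under k <-> N - k, identically in a and b, so the
   mixed second difference
     S(1,1) - S(u,1) - S(1,1/u) + S(u,1/u)
   is divisible by Phi_n * w * (1-u), hence by Phi_n^4.  The last three sums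
   terminate at k = N and Watson's transformation turns them into balanced sums
   over j whose terms with j >= 2 combine, modulo Phi_n^4, into the right-hand
   side; the constant Omega appears through the logarithmic derivative
   \sum_(0 < i < n/2) q^(2i)/(1-q^(2i))^2 = (1-n^2)/24 modulo Phi_n.
   For a proper divisor m > 1 of n both sides vanish modulo Phi_m, the left-hand
   one because the antisymmetry holds within each block of m consecutive terms.
   Divisibility is measured by the filtrations of the field of fractions given by
   the local rings at the primes Phi_m. *)

(** * Watson's transformation *)

(** The obstacle is that S(1,1) itself does not terminate at k = N, so Watson's transformation does
    not apply to it, while antisymmetry alone gives a single power of Phi_n. The deformation repairs
    both. At b = 1/u the factor (b/q;q^2)_k becomes (q^(-2N);q^2)_k, because 2N = n + 1; this forces
    termination at the cost of a change of order one. Moving a from 1 to u changes the sum by order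
    two, since only w enters. Antisymmetry supplies the fourth order. The index j = 2 comes from the
    factor (q^3/g;q^2)_(N-j) of Watson's coefficients, where g = u, 1, 1 for S(u,1), S(1,1/u),
    S(u,1/u). Its factor of index N - 2 is 1 - u/g, and it is present exactly for j < 2. There the
    first sum contributes 0 and the other two differ by order four. At j = 2 the difference of the
    last two coefficients is of order 1 + 2 (a factor 1 - u and a factor w), so the logarithmic
    derivative multiplying it matters only modulo Phi_n; this is how n^2 enters Omega. Reasoning
    with an abstract filtration allows exact identities between fractions in q, c, d, checked by
    [field], with only orders to be tracked. *)

Section QSeries.
Variables (F : fieldType) (p : F).

Definition poch (x : F) k := \prod_(i < k) (1 - x * p ^+ i).

Lemma poch0 x : poch x 0 = 1. Proof. exact: big_ord0. Qed.

Lemma pochS x k : poch x k.+1 = poch x k * (1 - x * p ^+ k).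
Proof. exact: big_ord_recr. Qed.

Lemma poch_recl x k : poch x k.+1 = (1 - x) * poch (x * p) k.
Proof.
rewrite /poch big_ord_recl expr0 mulr1; congr (_ * _); apply: eq_bigr => i _.
by rewrite exprS mulrA.
Qed.

Lemma pochD x j k : poch x (j + k) = poch x j * poch (x * p ^+ j) k.
Proof.
elim: k => [|k IH]; first by rewrite addn0 poch0 mulr1.
by rewrite addnS !pochS IH exprD !mulrA.
Qed.

Lemma poch_neq0 x k : (forall i, 1 - x * p ^+ i != 0) -> poch x k != 0.
Proof. by move=> h; apply/prodf_neq0 => i _. Qed.

(** This is p^(N r) (p^-N;p)_r, free of negative powers. The extra power turns the usual argument a
    p^(N+1)/(de) of the series into ap/(de). *)
Definition fallp N r := \prod_(i < r) (p ^+ N - p ^+ i).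

Lemma fallp0 N : fallp N 0 = 1. Proof. exact: big_ord0. Qed.

Lemma fallpS N r : fallp N r.+1 = fallp N r * (p ^+ N - p ^+ r).
Proof. exact: big_ord_recr. Qed.

Lemma fallp_eq0 N r : (N < r)%N -> fallp N r = 0.
Proof.
by move=> h; rewrite /fallp (bigD1 (Ordinal h)) //= subrr mul0r.
Qed.

Lemma fallpSS N r : fallp N.+1 r.+1 = p ^+ r * (p ^+ N.+1 - 1) * fallp N r.
Proof.
elim: r => [|r IH]; first by rewrite fallpS !fallp0 !expr0 mulr1 !mul1r.
rewrite fallpS IH (fallpS N r) !exprS; ring.
Qed.

Lemma fallpD N j s : (j <= N)%N ->
  fallp N (j + s) = fallp N j * (p ^+ j) ^+ s * fallp (N - j) s.
Proof.
move=> h; elim: s => [|s IH]; first by rewrite addn0 fallp0 expr0 !mulr1.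
have E : p ^+ N = p ^+ j * p ^+ (N - j) by rewrite -exprD subnKC.
rewrite addnS !fallpS IH E exprD exprSr; ring.
Qed.

(** The summand of the terminating very-well-poised 6phi5 series, multiplied by 1 - a so that this
    factor is never divided out. *)
Definition rogers_term (a d e : F) N r :=
  (1 - a * p ^+ r ^+ 2) * poch a r * poch d r * poch e r
    / (poch p r * poch (a * p / d) r * poch (a * p / e) r)
  * fallp N r / poch (a * p ^+ N.+1) r * (a * p / (d * e)) ^+ r.

(* The right-hand side is the WZ certificate of the recurrence in N. *)
Lemma rogers_telescope (a d e : F) N L :
    d != 0 -> e != 0 ->
    (forall i, 1 - p ^+ i.+1 != 0) -> (forall i, 1 - a * p ^+ i != 0) ->
    (forall i, 1 - a * p / d * p ^+ i != 0) ->
    (forall i, 1 - a * p / e * p ^+ i != 0) ->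
  \sum_(r < L.+1) (rogers_term a d e N.+1 r
     - (1 - a * p ^+ N.+1) * (1 - a * p / (d * e) * p ^+ N)
       / ((1 - a * p / d * p ^+ N) * (1 - a * p / e * p ^+ N))
       * rogers_term a d e N r)
  = p ^+ N * (1 - a * p ^+ N.+1)
       / ((1 - a * p / d * p ^+ N) * (1 - a * p / e * p ^+ N))
    * fallp N L / poch (a * p ^+ N.+1) L.+1 * (a * p / (d * e)) ^+ L.+1
    * poch a L.+1 * poch d L.+1 * poch e L.+1
    / (poch p L * poch (a * p / d) L * poch (a * p / e) L).
Proof.
move=> d0 e0 hp ha hd he.
have hp' i : 1 - p * p ^+ i != 0 by rewrite -exprS.
have hN : poch (a * p ^+ N.+1) L != 0.
  by apply: poch_neq0 => i; rewrite -mulrA -exprD.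
have hd' i : d - a * p * p ^+ i != 0.
  apply: contra (hd i) => /eqP h; apply/eqP.
  by rewrite mulrAC -[X in X - _](divff d0) -mulrBl h mul0r.
have he' i : e - a * p * p ^+ i != 0.
  apply: contra (he i) => /eqP h; apply/eqP.
  by rewrite mulrAC -[X in X - _](divff e0) -mulrBl h mul0r.
elim: L hN => [|L IH] hN.
  rewrite big_ord1 /rogers_term !fallp0 !poch0 !expr0 !pochS !poch0 !exprS !expr0.
  by field; rewrite oner_neq0 d0 e0 -exprS ha hd' he'.
rewrite big_ord_recr /= IH; last first.
  by apply: poch_neq0 => i; rewrite -mulrA -exprD.
rewrite /rogers_term fallpSS fallpS.
(* Both denominators are expressed through products based at a p^(N+1), so that [field] meets a
   single unknown product. *)
have E : poch (a * p ^+ N.+2) L.+1 =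
   poch (a * p ^+ N.+1) L * (1 - a * p ^+ N.+1 * p ^+ L)
     * (1 - a * p ^+ N.+1 * p ^+ L.+1) / (1 - a * p ^+ N.+1).
  apply: (mulIf (ha N.+1)); rewrite divfK // mulrC -!pochS.
  by rewrite [RHS]poch_recl -mulrA -exprSr.
rewrite E {E}.
have h1 := ha (N.+1 + L)%N; have h2 := ha (N.+1 + L.+1)%N.
have h3 := poch_neq0 L hp'; have h4 := poch_neq0 L hd; have h5 := poch_neq0 L he.
have h6 : poch (a * p ^+ N.+1) L != 0.
  by apply: poch_neq0 => i; rewrite -mulrA -exprD.
move: h1 h2 (ha N.+1) (hd' N) (he' N) (hd' L) (he' L) (hp' L) h3 h4 h5 h6 {hN IH}.
rewrite !pochS !exprD !exprS.
set A := poch a L; set D := poch d L; set E := poch e L.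
set P := poch p L; set D' := poch (a * p / d) L; set E' := poch (a * p / e) L.
set Z := poch (a * (p * _)) L; set f := fallp N L; set g := (_ / _) ^+ L.
move: A D E P D' E' Z f g => A D E P D' E' Z f g.
move: (p ^+ N) (p ^+ L) => x y h1 h2 h3 h4 h5 h6 h7 h8 h9 h10 h11 h12.
field.
rewrite d0 e0 h4 h5 h6 h7 h8 h9 h10 h11 h12 /= ?andbT.
by move: h1 h2 h3; rewrite !mulrA => -> -> ->.
Qed.

Lemma rogers_sum (a d e : F) N :
    d != 0 -> e != 0 ->
    (forall i, 1 - p ^+ i.+1 != 0) -> (forall i, 1 - a * p ^+ i != 0) ->
    (forall i, 1 - a * p / d * p ^+ i != 0) ->
    (forall i, 1 - a * p / e * p ^+ i != 0) ->
  \sum_(r < N.+1) rogers_term a d e N r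
  = poch a N.+1 * poch (a * p / (d * e)) N
    / (poch (a * p / d) N * poch (a * p / e) N).
Proof.
move=> d0 e0 hp ha hd he; elim: N => [|N IH].
  rewrite big_ord1 /rogers_term fallp0 !pochS !poch0 !expr0.
  by field; rewrite oner_neq0.
(* At L = N + 1 the certificate contains [fallp N N.+1], which is 0. *)
have := rogers_telescope N N.+1 d0 e0 hp ha hd he.
rewrite fallp_eq0 // !(mulr0, mul0r) big_split /= sumrN -mulr_sumr.
rewrite [X in _ - _ * X]big_ord_recr /= IH {2}/rogers_term fallp_eq0 //.
rewrite !(mulr0, mul0r) addr0 => /eqP; rewrite subr_eq0 => /eqP ->.
rewrite (pochS a N.+1) (pochS (a * p / (d * e))) (pochS (a * p / d)) (pochS (a * p / e)).
move: (hd N) (he N) (poch_neq0 N hd) (poch_neq0 N he).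
set A := 1 - a * p / d * _; set B := 1 - a * p / e * _.
move: A B => A B; move: (poch _ _) (poch _ _) (poch _ _) (poch _ _) => ? ? ? ?.
by move=> h1 h2 h3 h4; field; rewrite d0 e0 h1 h2 h3 h4.
Qed.

(* (p^-r)_j (a p^r)_j *)
Definition saal_factor (a : F) r j :=
  \prod_(i < j) ((1 - p ^+ i / p ^+ r) * (1 - a * p ^+ r * p ^+ i)).

(** The q-Pfaff-Saalschuetz summand. With g = ap/(bc) as a parameter in place of a, the lower
    parameters ap/b and ap/c become the products gc and gb, and a = gbc/p. *)
Definition saal_term (g b c : F) r j :=
  saal_factor (g * b * c / p) r j * poch g j * p ^+ j
  / (poch p j * poch (g * c) j * poch (g * b) j).

Lemma saal_factorS a r j : saal_factor a r j.+1 =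
  saal_factor a r j * ((1 - p ^+ j / p ^+ r) * (1 - a * p ^+ r * p ^+ j)).
Proof. exact: big_ord_recr. Qed.

Lemma saal_factor_eq0 a r j : p != 0 -> (r < j)%N -> saal_factor a r j = 0.
Proof.
move=> p0 h; rewrite /saal_factor (bigD1 (Ordinal h)) //=.
by rewrite divff ?expf_neq0 // subrr !mul0r.
Qed.

(* The common part of saal_factor a r j.+1 and saal_factor a r.+1 j.+1. *)
Definition saal_mid (a : F) r j :=
  \prod_(i < j) ((1 - p ^+ i / p ^+ r) * (1 - a * p ^+ r * p ^+ i.+1)).

Lemma saal_midS a r j : saal_mid a r j.+1 =
  saal_mid a r j * ((1 - p ^+ j / p ^+ r) * (1 - a * p ^+ r * p ^+ j.+1)).
Proof. exact: big_ord_recr. Qed.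

Lemma saal_factor_mid a r j : p != 0 -> 
  saal_factor a r j.+1 = saal_mid a r j * (1 - p ^+ j / p ^+ r) * (1 - a * p ^+ r).
Proof.
move=> p0; elim: j => [|j IH].
  by rewrite saal_factorS /saal_factor /saal_mid !big_ord0 expr0; ring.
by rewrite saal_factorS IH saal_midS; ring.
Qed.

Lemma saal_factor_midS a r j : p != 0 ->
  saal_factor a r.+1 j.+1 = saal_mid a r j * (1 - (p ^+ r.+1)^-1)
    * (1 - a * p ^+ r.+1 * p ^+ j).
Proof.
move=> p0; have pr := expf_neq0 r p0; elim: j => [|j IH].
  by rewrite saal_factorS /saal_factor /saal_mid !big_ord0 expr0; ring.
rewrite saal_factorS IH saal_midS !exprS.
by field; rewrite p0 pr.
Qed.

Lemma saal_telescope (g b c : F) r L :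
    p != 0 -> (forall i, 1 - p ^+ i.+1 != 0) ->
    (forall i, 1 - g * b * p ^+ i != 0) -> (forall i, 1 - g * c * p ^+ i != 0) ->
  \sum_(j < L.+1) (saal_term g b c r.+1 j
     - (1 - b * p ^+ r) * (1 - c * p ^+ r) * g
       / ((1 - g * b * p ^+ r) * (1 - g * c * p ^+ r)) * saal_term g b c r j)
  = (1 - g * b * c * p ^+ r * p ^+ r) / ((1 - g * b * p ^+ r) * (1 - g * c * p ^+ r))
    * saal_mid (g * b * c / p) r L * poch g L.+1
    / (poch p L * poch (g * c) L * poch (g * b) L).
Proof.
move=> p0 hp hb hc.
have hp' i : 1 - p * p ^+ i != 0 by rewrite -exprS.
elim: L => [|L IH].
  rewrite big_ord1 /saal_term /saal_mid /saal_factor !big_ord0 !poch0 !pochS !poch0 !expr0.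
  by field; rewrite oner_neq0 hb hc.
rewrite big_ord_recr /= IH /saal_term saal_factor_midS // saal_factor_mid //.
rewrite saal_midS.
move: (hb r) (hc r) (hb L) (hc L) (hp' L) (expf_neq0 r p0).
move: (poch_neq0 L hb) (poch_neq0 L hc) (poch_neq0 L hp').
rewrite !pochS !exprS.
set P := poch p L; set C := poch (g * c) L; set B := poch (g * b) L.
set G := poch g L; set S := saal_mid _ _ _.
move: P B C G S => P B C G S; move: (p ^+ r) (p ^+ L) => x y.
move=> h1 h2 h3 h4 h5 h6 h7 h8 h9.
field.
by rewrite p0 h1 h2 h3 h4 h5 h6 h7 h8 h9.
Qed.

Lemma saal_sum (g b c : F) r :
    p != 0 -> (forall i, 1 - p ^+ i.+1 != 0) ->
    (forall i, 1 - g * b * p ^+ i != 0) -> (forall i, 1 - g * c * p ^+ i != 0) ->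
  \sum_(j < r.+1) saal_term g b c r j
  = poch b r * poch c r * g ^+ r / (poch (g * c) r * poch (g * b) r).
Proof.
move=> p0 hp hb hc; elim: r => [|r IH].
  rewrite big_ord1 /saal_term /saal_factor !big_ord0 !poch0 !expr0.
  by field; rewrite oner_neq0.
have := saal_telescope r r.+1 p0 hp hb hc.
(* At L = r + 1 the certificate contains the factor 1 - p^r/p^r. *)
rewrite saal_midS divff ?expf_neq0 // subrr !(mulr0, mul0r).
rewrite big_split /= sumrN -mulr_sumr [X in _ - _ * X]big_ord_recr /= IH.
rewrite {2}/saal_term saal_factor_eq0 // !(mulr0, mul0r) addr0.
move/eqP; rewrite subr_eq0 => /eqP ->.
rewrite !pochS exprS.
move: (hb r) (hc r) (poch_neq0 r hb) (poch_neq0 r hc).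
by move=> h1 h2 h3 h4; field; rewrite h1 h2 h3 h4.
Qed.

(* The usual quotient (ap/de)_N / (de p^-N/a)_j is written without division, which
   keeps Watson's formula valid when de p^-N/a is a negative power of p. *)
Definition watson_coef (a d e : F) N j :=
  poch a N.+1 * poch d j * poch e j
    / (poch (a * p / d) N * poch (a * p / e) N)
  * poch (a * p / (d * e)) (N - j) * (a * p / (d * e)) ^+ j
  * \prod_(i < j) (- (p ^+ i / p ^+ j)) * fallp N j.

(** Reversal of (p^-(j+s);p)_j: each factor on the left is a monomial times the factor of index j -
    1 - i of (p^(s+1);p)_j. *)
Lemma prod_inv_flip j s : p != 0 ->
  \prod_(i < j) (1 - p ^+ i / p ^+ (j + s))
   = \prod_(i < j) (- (p ^+ i / p ^+ j)) / p ^+ j ^+ s * poch (p * p ^+ s) j.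
Proof.
move=> p0; rewrite /poch [X in _ * X](reindex_inj rev_ord_inj) /=.
have -> : (p ^+ j ^+ s)^-1 = \prod_(i < j) (p ^+ s)^-1.
  by rewrite prodr_const card_ord exprVn -!exprM mulnC.
rewrite -!big_split /=; apply: eq_bigr => i _.
have pj k : p ^+ k != 0 by rewrite expf_neq0.
have E : p ^+ j = p ^+ i * (p * p ^+ (j - i.+1)).
  by rewrite -exprS -exprD; congr (_ ^+ _); have := ltn_ord i; lia.
rewrite exprD E; field.
by rewrite p0 !pj.
Qed.

Lemma sum_ordD (f : nat -> F) m k :
  \sum_(i < m + k) f i = \sum_(i < m) f i + \sum_(i < k) f (m + i)%N.
Proof. exact: big_split_ord. Qed.

(** The inserted factor (p^-r)_j (a p^r)_j kills the terms r < j. After r = j + s the sum is again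
    of Rogers' type, with a p^(2j), d p^j, e p^j, N - j, and with ap/(de) unchanged. *)
Lemma rogers_sum_shift (a d e : F) N j :
    p != 0 -> d != 0 -> e != 0 ->
    (forall i, 1 - p ^+ i.+1 != 0) -> (forall i, 1 - a * p ^+ i != 0) ->
    (forall i, 1 - a * p / d * p ^+ i != 0) ->
    (forall i, 1 - a * p / e * p ^+ i != 0) -> (j <= N)%N ->
  \sum_(r < N.+1) rogers_term a d e N r * saal_factor a r j = watson_coef a d e N j.
Proof.
move=> p0 d0 e0 hp ha hd he jN.
have pk k : p ^+ k != 0 by rewrite expf_neq0.
have hp' i : 1 - p * p ^+ i != 0 by rewrite -exprS.
have haN k i : 1 - a * p ^+ k * p ^+ i != 0 by rewrite -mulrA -exprD.
have hdj i : 1 - a * p / d * p ^+ j * p ^+ i != 0 by rewrite -mulrA -exprD.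
have hej i : 1 - a * p / e * p ^+ j * p ^+ i != 0 by rewrite -mulrA -exprD.
pose a' := a * p ^+ j ^+ 2; pose d' := d * p ^+ j; pose e' := e * p ^+ j.
have Ed : a' * p / d' = a * p / d * p ^+ j by rewrite /a' /d'; field; rewrite d0 pk.
have Ee : a' * p / e' = a * p / e * p ^+ j by rewrite /a' /e'; field; rewrite e0 pk.
have Ede : a' * p / (d' * e') = a * p / (d * e).
  by rewrite /a' /d' /e'; field; rewrite d0 e0 pk.
have Ea : a' = a * p ^+ (j + j) by rewrite /a' exprD -expr2.
pose K := poch a (j + j) * poch d j * poch e j
   / (poch (a * p / d) j * poch (a * p / e) j)
   * fallp N j / poch (a * p ^+ N.+1) j * (a * p / (d * e)) ^+ j
   * \prod_(i < j) (- (p ^+ i / p ^+ j)).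
have := sum_ordD (fun r => rogers_term a d e N r * saal_factor a r j) j (N - j).+1.
rewrite addnS subnKC // => ->.
rewrite big1 ?add0r; last by move=> i _; rewrite saal_factor_eq0 ?mulr0.
transitivity (\sum_(s < (N - j).+1) K * rogers_term a' d' e' (N - j) s).
  apply: eq_bigr => s _; rewrite /saal_factor big_split /= prod_inv_flip //.
  have -> : \prod_(i < j) (1 - a * p ^+ (j + s) * p ^+ i) =
     poch a (j + j) * poch a' s / poch a (j + s).
    apply: (canRL (mulfK _)); first exact: poch_neq0.
    rewrite Ea -pochD -/(poch (a * p ^+ (j + s)) j) mulrC -pochD.
    by congr (poch _ _); lia.
  rewrite /rogers_term /K Ed Ee Ede fallpD //.
  rewrite (pochD d) (pochD e) (pochD (a * p / d)) (pochD (a * p / e)).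
  rewrite (pochD (a * p ^+ N.+1)).
  have -> : poch p (j + s) = poch p s * poch (p * p ^+ s) j by rewrite addnC pochD.
  have -> : a' * p ^+ (N - j).+1 = a * p ^+ N.+1 * p ^+ j.
    by rewrite Ea -!mulrA -!exprD; congr (_ * _ ^+ _); lia.
  have -> : 1 - a * p ^+ (j + s) ^+ 2 = 1 - a' * p ^+ s ^+ 2.
    by rewrite /a' exprD; congr (1 - _); ring.
  have hps i : 1 - p * p ^+ s * p ^+ i != 0 by rewrite -mulrA -exprD.
  have haNj i : 1 - a * p ^+ N.+1 * p ^+ j * p ^+ i != 0.
    by rewrite -!mulrA -!exprD.
  rewrite -/d' -/e' exprD.
  move: (poch_neq0 s hp') (poch_neq0 j hps) (poch_neq0 j hd) (poch_neq0 j he).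
  move: (poch_neq0 s hdj) (poch_neq0 s hej) (poch_neq0 (j + s) ha).
  move: (poch_neq0 j (haN N.+1)) (poch_neq0 s haNj) (expf_neq0 s (pk j)).
  set g := a * p / (d * e); move: (1 - _) (p ^+ j ^+ s) (g ^+ j) (g ^+ s).
  move: (poch _ s) (poch _ s) (poch _ s) (poch _ s) (poch _ s) (poch _ s) (poch _ s).
  move: (poch _ j) (poch _ j) (poch _ j) (poch _ j) (poch _ j) (poch _ j).
  move: (poch _ _) (poch _ _) (fallp _ _) (fallp _ _) (\prod_(i < j) _).
  move=> *; field; do ?[apply/andP; split]; assumption.
rewrite -mulr_sumr rogers_sum ?Ed ?Ee ?Ede //; first last.
- by move=> i; rewrite Ea.
- by rewrite mulf_neq0.
- by rewrite mulf_neq0.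
have pochN x : poch x N = poch x j * poch (x * p ^+ j) (N - j).
  by rewrite -pochD subnKC.
rewrite /K /watson_coef (pochN (a * p / d)) (pochN (a * p / e)) Ea.
have -> : poch a N.+1 = poch a (j + j) * poch (a * p ^+ (j + j)) (N - j).+1
    / poch (a * p ^+ N.+1) j.
  apply: (canRL (mulfK _)); first exact: poch_neq0.
  by rewrite -!pochD; congr (poch _ _); lia.
move: (poch_neq0 j hd) (poch_neq0 j he) (poch_neq0 (N - j) hdj) (poch_neq0 (N - j) hej).
move: (poch_neq0 j (haN N.+1)).
move=> h1 h2 h3 h4 h5.
field.
by rewrite h1 h2 h3 h4 h5.
Qed.

(** The quotient in b and c is expanded into a sum over j by q-Saalschuetz. After exchanging the
    summations, [rogers_sum_shift] evaluates the inner sum over r. *)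
Lemma watson (a b c d e : F) N :
    p != 0 -> b != 0 -> c != 0 -> d != 0 -> e != 0 ->
    (forall i, 1 - p ^+ i.+1 != 0) -> (forall i, 1 - a * p ^+ i != 0) ->
    (forall i, 1 - a * p / b * p ^+ i != 0) ->
    (forall i, 1 - a * p / c * p ^+ i != 0) ->
    (forall i, 1 - a * p / d * p ^+ i != 0) ->
    (forall i, 1 - a * p / e * p ^+ i != 0) ->
  \sum_(r < N.+1) rogers_term a d e N r
    * (poch b r * poch c r * (a * p / (b * c)) ^+ r
       / (poch (a * p / b) r * poch (a * p / c) r))
  = \sum_(j < N.+1) watson_coef a d e N j
    * (poch (a * p / (b * c)) j * p ^+ j
       / (poch p j * poch (a * p / b) j * poch (a * p / c) j)).
Proof.
move=> p0 b0 c0 d0 e0 hp ha hb hc hd he.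
set g := a * p / (b * c).
have Eb : g * c = a * p / b by rewrite /g; field; rewrite b0 c0.
have Ec : g * b = a * p / c by rewrite /g; field; rewrite b0 c0.
have Ea : g * b * c / p = a by rewrite /g; field; rewrite p0 b0 c0.
transitivity (\sum_(r < N.+1) \sum_(j < N.+1)
    (rogers_term a d e N r * saal_term g b c r j)).
  apply: eq_bigr => r _; rewrite -mulr_sumr; congr (_ * _).
  have hgb i : 1 - g * b * p ^+ i != 0 by rewrite Ec.
  have hgc i : 1 - g * c * p ^+ i != 0 by rewrite Eb.
  rewrite -Eb -Ec -saal_sum //.
  have := sum_ordD (saal_term g b c r) r.+1 (N - r).
  rewrite addSn subnKC; last by have := ltn_ord r.
  move=> ->; rewrite [X in _ + X]big1 ?addr0 // => i _.
  by rewrite /saal_term saal_factor_eq0 ?mul0r //; lia.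
rewrite exchange_big /=; apply: eq_bigr => j _.
rewrite -(rogers_sum_shift p0 d0 e0 hp ha hd he) ?mulr_suml; last by have := ltn_ord j.
by apply: eq_bigr => r _; rewrite /saal_term Ea Eb Ec !mulrA.
Qed.
End QSeries.

(** * Filtrations by powers of a prime *)

(* The model: lev e is the e-th power of the maximal ideal of a local ring. *)
Record filtration (F : fieldType) := Filtration {
  lev :> nat -> F -> Prop;
  lev0 : forall e, lev e 0;
  lev1 : lev 0 1;
  levD : forall e x y, lev e x -> lev e y -> lev e (x + y);
  levN : forall e x, lev e x -> lev e (- x);
  levM : forall e f x y, lev e x -> lev f y -> lev (e + f) (x * y);
  lev_leq : forall e f x, (e <= f)%N -> lev f x -> lev e x;
  lev_local : forall x, lev 1 (x - 1) -> x != 0 /\ lev 0 x^-1 }.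

Section Filtration.
Variables (F : fieldType) (I : filtration F).
Implicit Types x y z t : F.

Definition lunit x := [/\ x != 0, I 0 x & I 0 x^-1].

Lemma levB e x y : I e x -> I e y -> I e (x - y).
Proof. by move=> hx hy; apply: levD => //; apply: levN. Qed.

Lemma levMl e x y : I 0 x -> I e y -> I e (x * y).
Proof. by move=> hx hy; rewrite -[e]add0n; apply: levM. Qed.

Lemma levMr e x y : I e x -> I 0 y -> I e (x * y).
Proof. by move=> hx hy; rewrite mulrC; apply: levMl. Qed.

Lemma lev_w e x : I e x -> I 0 x. Proof. exact: lev_leq. Qed.

Lemma lev_nat k : I 0 k%:R.
Proof.
elim: k => [|k IH]; first exact: lev0.
by rewrite -addn1 natrD; apply: levD => //; apply: lev1.
Qed.

Lemma levX x k : I 0 x -> I 0 (x ^+ k).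
Proof.
by move=> hx; elim: k => [|k IH]; rewrite ?expr0 ?exprS; [apply: lev1|apply: levMl].
Qed.

Lemma lev_sum e k (f : nat -> F) :
  (forall i, (i < k)%N -> I e (f i)) -> I e (\sum_(i < k) f i).
Proof.
move=> h; elim/big_rec: _ => [|i x _ hx]; first exact: lev0.
by apply: levD => //; apply: h.
Qed.

Lemma lev_prod k (f : nat -> F) :
  (forall i, (i < k)%N -> I 0 (f i)) -> I 0 (\prod_(i < k) f i).
Proof.
move=> h; elim/big_rec: _ => [|i x _ hx]; first exact: lev1.
by apply: levMl => //; apply: h.
Qed.

Lemma lunit1 : lunit 1.
Proof. by split; rewrite ?invr1 ?oner_neq0 //; apply: lev1. Qed.

Lemma lunit_lev x : lunit x -> I 0 x. Proof. by case. Qed.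

Lemma lunit_neq0 x : lunit x -> x != 0. Proof. by case. Qed.

Lemma lunitV x : lunit x -> lunit x^-1.
Proof. by case=> h1 h2 h3; split; rewrite ?invrK ?invr_eq0. Qed.

Lemma lunitM x y : lunit x -> lunit y -> lunit (x * y).
Proof.
case=> h1 h2 h3 [k1 k2 k3]; split; rewrite ?mulf_neq0 ?invfM //; exact: levMl.
Qed.

Lemma lunitN x : lunit x -> lunit (- x).
Proof.
by case=> h1 h2 h3; split; [rewrite oppr_eq0|exact: levN|rewrite invrN; exact: levN].
Qed.

Lemma lunitX x k : lunit x -> lunit (x ^+ k).
Proof.
move=> h; elim: k => [|k IH]; rewrite ?expr0 ?exprS; [exact: lunit1|exact: lunitM].
Qed.

Lemma lunit_prod k (f : nat -> F) :
  (forall i, (i < k)%N -> lunit (f i)) -> lunit (\prod_(i < k) f i).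
Proof.
move=> h; elim/big_rec: _ => [|i x _ hx]; first exact: lunit1.
by apply: lunitM => //; apply: h.
Qed.

Lemma lev_div e x y : I e x -> lunit y -> I e (x / y).
Proof. by move=> hx [_ _ hy]; apply: levMr. Qed.

Definition cg e x y := I e (x - y).

Lemma cg_refl e x : cg e x x. Proof. by rewrite /cg subrr; apply: lev0. Qed.

Lemma cg_sym e x y : cg e x y -> cg e y x.
Proof. by rewrite /cg => h; rewrite -opprB; apply: levN. Qed.

Lemma cg_trans e y x z : cg e x y -> cg e y z -> cg e x z.
Proof.
rewrite /cg => h k; have -> : x - z = (x - y) + (y - z) by ring.
exact: levD.
Qed.

Lemma cgD e x y z t : cg e x y -> cg e z t -> cg e (x + z) (y + t).
Proof.
rewrite /cg => h k; have -> : x + z - (y + t) = (x - y) + (z - t) by ring.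
exact: levD.
Qed.

Lemma cgN e x y : cg e x y -> cg e (- x) (- y).
Proof.
rewrite /cg => h; have -> : - x - - y = - (x - y) by ring.
exact: levN.
Qed.

Lemma cgB e x y z t : cg e x y -> cg e z t -> cg e (x - z) (y - t).
Proof. by move=> h k; apply: cgD => //; apply: cgN. Qed.

Lemma cg_lev e x y : cg e x y -> I 0 y -> I 0 x.
Proof. by move=> /lev_w h k; rewrite -(subrK y x); apply: levD. Qed.

Lemma cgM e x y z t : I 0 y -> I 0 t -> cg e x y -> cg e z t -> cg e (x * z) (y * t).
Proof.
move=> hy ht h k; have hz := cg_lev k ht; rewrite /cg.
have -> : x * z - y * t = (x - y) * z + y * (z - t) by ring.
by apply: levD; [apply: levMr|apply: levMl].
Qed.

Lemma cgX e x y k : I 0 y -> cg e x y -> cg e (x ^+ k) (y ^+ k).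
Proof.
move=> hy h; elim: k => [|k IH]; first by rewrite !expr0; apply: cg_refl.
by rewrite !exprS; apply: cgM => //; apply: levX.
Qed.

Lemma cg_le e f x y : (e <= f)%N -> cg f x y -> cg e x y.
Proof. exact: lev_leq. Qed.

(** The quotient y/x lies in 1 plus the maximal ideal, where [lev_local] provides inverses. *)
Lemma lunit_cg x y : lunit x -> cg 1 y x -> lunit y.
Proof.
move=> [h1 h2 h3] h.
have /(@lev_local _ I) [k1 k2] : I 1 (y / x - 1).
  by rewrite -(divff h1) -mulrBl; apply: levMr.
have y0 : y != 0 by apply: contraNneq k1 => ->; rewrite mul0r.
split=> //; first exact: cg_lev h h2.
have -> : y^-1 = (y / x)^-1 * x^-1 by field; rewrite h1 y0.
exact: levMl.
Qed.

Lemma cgV e x y : lunit x -> lunit y -> cg e x y -> cg e x^-1 y^-1.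
Proof.
rewrite /cg => -[x0 _ hx] [y0 _ hy] h.
have -> : x^-1 - y^-1 = - (x^-1 * (x - y) * y^-1) by field; rewrite x0 y0.
by apply/levN/levMr => //; apply/levMl.
Qed.

Lemma cg_div e x y z t : I 0 y -> lunit z -> lunit t ->
  cg e x y -> cg e z t -> cg e (x / z) (y / t).
Proof. by move=> hy hz ht h k; apply: cgM => //; [case: ht|apply: cgV]. Qed.

Lemma cg_prod e k (f g : nat -> F) :
  (forall i, (i < k)%N -> I 0 (g i)) -> (forall i, (i < k)%N -> cg e (f i) (g i)) ->
  cg e (\prod_(i < k) f i) (\prod_(i < k) g i).
Proof.
move=> hg; elim: k hg => [|k IH] hg h; first by rewrite !big_ord0; apply: cg_refl.
rewrite !big_ord_recr /=; apply: cgM.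
- by apply: lev_prod => i hi; apply: hg; apply: ltnW.
- exact: hg.
- by apply: IH => i hi; [apply: hg|apply: h]; apply: ltnW.
- exact: h.
Qed.

Lemma cg_sum e k (f g : nat -> F) :
  (forall i, (i < k)%N -> cg e (f i) (g i)) ->
  cg e (\sum_(i < k) f i) (\sum_(i < k) g i).
Proof. by move=> h; rewrite /cg -sumrB; apply: (@lev_sum _ _ (fun i => f i - g i)). Qed.

End Filtration.

Ltac lv := repeat first
  [ assumption | apply: lev1 | apply: lev0 | apply: lev_nat
  | apply: levD | apply: levN | apply: levMl | apply: levX
  | (apply: lunit_lev; assumption) ].

Ltac cgt := repeat first
  [ assumption | apply: cg_refl | apply: cgM | apply: cgX | apply: cgD | apply: cgN ]; lv.

(** Reversing only the denominators gives numerator and denominator indices of constant sum; for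
    such pairs each factor has a simple residue modulo Phi_m. *)
Lemma prod_ratio_rev (F : fieldType) (f g : nat -> F) s L :
  \prod_(l < L) (f (s + l)%N / g (s + l)%N) =
  \prod_(l < L) (f (s + l)%N / g (s + (L - l.+1))%N).
Proof.
rewrite !big_split /=; congr (_ * _).
by rewrite (reindex_inj rev_ord_inj).
Qed.

Lemma prod_ordD (F : fieldType) (f : nat -> F) m k :
  \prod_(i < m + k) f i = \prod_(i < m) f i * \prod_(i < k) f (m + i)%N.
Proof. exact: big_split_ord. Qed.

Definition oddq (F : fieldType) (q : F) (i : nat) := q ^+ (2 * i) / q.
Definition evenq (F : fieldType) (q : F) (i : nat) := q ^+ (2 * i + 2).

(* The six numerator/denominator pairs of the summand all have this shape, up to
   powers of the parameter: (b/q;q^2)_k / (q^2/b;q^2)_k = b^k \prod_(i < k) hf b i *)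
Definition hf (F : fieldType) (q b : F) (i : nat) :=
  (1 - b * oddq q i) / (b - evenq q i).

(** * Congruences modulo powers of one cyclotomic polynomial *)

Section Sides.
Variables (F : fieldType) (q c d : F).
Notation P := (poch (q ^+ 2)).

(** The two sides are restated over an arbitrary field, so that the local argument uses nothing but
    a filtration and a few units. *)
Definition lhs_side M := \sum_(k < M.+1)
  (1 - q ^+ (4 * k) / q) / (1 - q) * (P q^-1 k ^+ 4 * P (c / q) k * P (d / q) k)
  / (P (q ^+ 2) k ^+ 4 * P (q ^+ 2 / c) k * P (q ^+ 2 / d) k) * (q ^+ 7 / (c * d)) ^+ k.

Definition Omega_side n :=
  ((1 - q ^+ n) / (1 - q)) ^+ 3 *
  (((n ^ 2)%N%:R * (1 - q) ^+ 2 - (1 + 22%:R * q + q ^+ 2)) / 24%:R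
     - 1 / (q * ((1 - q ^+ n) / (1 - q)) ^+ 2 * ((1 - q ^+ n.-1) / (1 - q))
            * ((1 - q ^+ n.+1) / (1 - q))))
  * q ^+ ((n + 5)./2) / (1 + q ^+ 2).

Definition rhs_side n :=
  Omega_side n * (1 - q) ^+ 2 * P (q ^+ 3 / (c * d)) 2
    / ((1 + q) ^+ 2 * P (q ^+ 2 / c) 2 * P (q ^+ 2 / d) 2)
  * \sum_(k < ((n - 3) %/ 2).+1)
      P (q ^+ 3) k ^+ 3 * P (q ^+ 7 / (c * d)) k
      / (P (q ^+ 2) k * P (q ^+ 6) k * P (q ^+ 6 / c) k * P (q ^+ 6 / d) k)
      * q ^+ (2 * k).
End Sides.

Section Cyclotomic.
Variables (F : fieldType) (I : filtration F) (q c d : F) (m : nat).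
Hypotheses (m_gt1 : (1 < m)%N) (m_odd : odd m).
Hypotheses (q_unit : lunit I q) (c_unit : lunit I c) (d_unit : lunit I d).
Hypothesis qm1 : cg I 1 (q ^+ m) 1.
Hypothesis q_sub1 : forall j, ~~ (m %| j)%N -> lunit I (1 - q ^+ j).
Hypothesis c_sub : forall j, lunit I (c - q ^+ j).
Hypothesis d_sub : forall j, lunit I (d - q ^+ j).
Hypothesis nat_unit : forall k, lunit I k.+1%:R.
Hypothesis q_neq1 : forall j, (0 < j)%N -> 1 - q ^+ j != 0.

(** H is the N of the overview, taken for m, where m will be n itself or a proper divisor of n. *)
Let H := half m.+1.
Notation x := (oddq q).
Notation y := (evenq q).
Notation hf := (hf q).

Lemma q_neq0 : q != 0. Proof. exact: lunit_neq0 q_unit. Qed.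

Lemma half_mE : (2 * H = m.+1)%N.
Proof. by rewrite /H; lia. Qed.

Lemma lev_q k : I 0 (q ^+ k). Proof. exact/levX/lunit_lev. Qed.

Lemma lev_qV k : I 0 (q ^+ k)^-1. Proof. by case: (lunitX k q_unit). Qed.

Lemma lev_x i : I 0 (x i).
Proof.
by apply: lev_div => //; apply/levX/lunit_lev.
Qed.

Lemma lev_y i : I 0 (y i). Proof. exact/levX/lunit_lev. Qed.

Lemma cg_qm k : cg I 1 (q ^+ (m * k)) 1.
Proof.
have -> : 1 = 1 ^+ k :> F by rewrite expr1n.
by rewrite exprM; apply: cgX => //; apply: lev1.
Qed.

(** * Antisymmetry of the summand modulo Phi_m *)

Lemma cg_xy i i' k : (2 * (i + i') + 1 = m * k)%N -> cg I 1 (x i * y i') 1.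
Proof.
move=> h; rewrite /oddq /evenq mulrAC -exprD.
have -> : (2 * i + (2 * i' + 2) = (m * k).+1)%N by lia.
by rewrite exprS mulrAC divff ?q_neq0 // mul1r; apply: cg_qm.
Qed.

(** Modulo Phi_m the element y_i' is inverse to x_i, and 1 - bx = -x (b - 1/x). The residue does not
    contain b, which is why antisymmetry survives the deformation. *)
Lemma hf_pair b i i' k : (2 * (i + i') + 1 = m * k)%N -> lunit I (b - y i') -> I 0 b ->
  cg I 1 ((1 - b * x i) / (b - y i')) (- x i).
Proof.
move=> h hu hb; have := cg_xy h.
rewrite /cg => hxy.
have -> : (1 - b * x i) / (b - y i') - - x i = (1 - x i * y i') / (b - y i').
  by field; rewrite (lunit_neq0 hu).
by apply: lev_div => //; rewrite -opprB; apply: levN.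
Qed.

Lemma oney_unit i : ~~ (m %| i.+1)%N -> lunit I (1 - y i).
Proof.
move=> h; apply: q_sub1; have -> : (2 * i + 2 = 2 * i.+1)%N by lia.
by rewrite Gauss_dvdr // coprimen2.
Qed.

(** At b = 1 this is the ratio of consecutive summands without the factor [4k-1]; the powers of c
    and d split off by [hf] cancel those in q^7/(cd). *)
Definition gf b (i : nat) := q ^+ 7 * hf 1 i ^+ 3 * hf b i * hf c i * hf d i.

Lemma lev_hf b i : I 0 b -> lunit I (b - y i) -> I 0 (hf b i).
Proof.
move=> hb hu; apply: lev_div => //; apply: levB; first exact: lev1.
by apply: levMl => //; apply: lev_x.
Qed.

(** Since s + L <= B + H, the numbers s + i + 1 lie strictly between B and B + m. *)
Lemma block_range B s L i : (m %| B)%N -> (2 * s + L = 2 * B + H)%N -> (B <= s)%N ->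
  (i < L)%N -> ~~ (m %| (s + i).+1)%N.
Proof.
move=> /dvdnP [k ->] h1 h2 h3.
have hH := half_mE.
have -> : ((s + i).+1 = k * m + (s + i - k * m).+1)%N by lia.
rewrite dvdn_addr ?dvdn_mull //; apply/negP => /dvdn_leq -/(_ isT); lia.
Qed.

Lemma prod_q_exp s L : \prod_(l < L) (q ^+ 7 * x (s + l) ^+ 6) =
  q ^+ (L * (12 * s + 6 * L - 5)).
Proof.
have q0 := q_neq0; elim: L => [|L IH]; first by rewrite big_ord0 mul0n expr0.
rewrite big_ord_recr /= IH.
have -> : (L.+1 * (12 * s + 6 * L.+1 - 5) =
   L * (12 * s + 6 * L - 5) + (12 * (s + L) + 1))%N by case: L {IH} => [|L]; nia.
rewrite exprD; congr (_ * _).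
have -> : q ^+ (12 * (s + L) + 1) = q ^+ (2 * (s + L)) ^+ 6 * q.
  by rewrite -exprM -exprSr; congr (_ ^+ _); lia.
by rewrite /oddq; field.
Qed.

(* Multiplied by the product of gf 1 over i < s this is the sum of the summands of
   index s and s + L, which lie symmetrically in the block starting at B. *)
Lemma antisym_bracket B s L : (m %| B)%N -> (2 * s + L = 2 * B + H)%N -> (B <= s)%N ->
  I 1 ((1 - q ^+ (4 * s) / q) + (1 - q ^+ (4 * (s + L)) / q)
        * \prod_(l < L) gf 1 (s + l)).
Proof.
move=> dB h1 h2; have q0 := q_neq0; have hH := half_mE; have [k Bk] := dvdnP dB.
have hr l : (l < L)%N -> ~~ (m %| (s + l).+1)%N by apply: block_range dB h1 h2.
have hu b i : b = 1 \/ b = c \/ b = d -> (i < L)%N -> lunit I (b - y (s + i)).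
  by move=> [->|[->|->]] hi; [apply/oney_unit/hr|apply: c_sub|apply: d_sub].
have hp b : b = 1 \/ b = c \/ b = d -> 
    cg I 1 (\prod_(l < L) hf b (s + l)) (\prod_(l < L) (- x (s + l))).
  move=> hb; rewrite (prod_ratio_rev (fun i => 1 - b * x i) (fun i => b - y i)).
  apply: (@cg_prod _ _ _ _ (fun l => (1 - b * x (s + l)) / (b - y (s + (L - l.+1))))
    (fun l => - x (s + l))) => i hi; first by apply/levN/lev_x.
  (* The paired indices add up to 2s + L - 1, and 2(2s + L - 1) + 1 = 4B + m. *)
  apply: (@hf_pair _ _ _ (4 * k + 1)); first by nia.
  - by apply: hu => //; lia.
  - by case: hb => [->|[->|->]]; [apply: lev1|apply: lunit_lev|apply: lunit_lev].
have O1 : I 0 (\prod_(l < L) (- x (s + l))).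
  by apply: (@lev_prod _ _ _ (fun l => - x (s + l))) => i _; apply/levN/lev_x.
have hp1 := hp 1 (or_introl erefl); have hpc := hp c (or_intror (or_introl erefl)).
have hpd := hp d (or_intror (or_intror erefl)).
have E : cg I 1 (\prod_(l < L) gf 1 (s + l)) (q ^+ (L * (12 * s + 6 * L - 5))).
  have -> : \prod_(l < L) gf 1 (s + l) = \prod_(l < L) q ^+ 7
      * (\prod_(l < L) hf 1 (s + l)) ^+ 3 * \prod_(l < L) hf 1 (s + l)
      * \prod_(l < L) hf c (s + l) * \prod_(l < L) hf d (s + l).
    by rewrite -prodrXl -!big_split.
  have -> : q ^+ (L * (12 * s + 6 * L - 5)) = \prod_(l < L) q ^+ 7
      * (\prod_(l < L) (- x (s + l))) ^+ 3 * \prod_(l < L) (- x (s + l))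
      * \prod_(l < L) (- x (s + l)) * \prod_(l < L) (- x (s + l)).
    by rewrite -prod_q_exp -prodrXl -!big_split; apply: eq_bigr => l _ /=; ring.
  have Oq : I 0 (\prod_(i < L) q ^+ 7) by rewrite prodr_const; apply/levX/lev_q.
  by cgt.
set P := \prod_(l < L) _ in E *; set e := (L * _)%N in E.
(* Both exponents are -2L modulo m, because e + 2L = L(12B + 3m) and 4s - 1 + 2L = 4B + m. *)
have E1 : cg I 1 (q ^+ e) (q ^+ (4 * s) / q).
  have -> : q ^+ e = q ^+ (m * (12 * k * L + 3 * L)) / q ^+ (2 * L).
    apply: (canRL (mulfK _)); first by rewrite expf_neq0.
    rewrite -exprD; congr (_ ^+ _); rewrite /e.
    have -> : (m * (12 * k * L + 3 * L) = L * (m * (12 * k + 3)))%N by lia.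
    case: (posnP L) => [->|L0]; first by rewrite !mul0n.
    have -> : (m * (12 * k + 3) = 12 * s + 6 * L - 5 + 2)%N by nia.
    by rewrite mulnDr [(L * 2)%N]mulnC.
  have -> : q ^+ (4 * s) / q = q ^+ (m * (4 * k + 1)) / q ^+ (2 * L).
    apply/eqP; rewrite eqr_div ?expf_neq0 // -exprD -exprSr; apply/eqP.
    by congr (_ ^+ _); nia.
  apply: cgM; [exact: lev_q|exact: lev_qV| |exact: cg_refl].
  by apply: (cg_trans (cg_qm _)); apply/cg_sym/cg_qm.
have E2 : cg I 1 (q ^+ (4 * s) / q * (q ^+ (4 * (s + L)) / q)) 1.
  have -> : q ^+ (4 * s) / q * (q ^+ (4 * (s + L)) / q) = q ^+ (m * (8 * k + 2)).
    rewrite mulf_div -exprD -expr2; apply: (canLR (mulfK _)).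
      by rewrite expf_neq0.
    by rewrite -exprD; congr (_ ^+ _); nia.
  exact: cg_qm.
set a := q ^+ (4 * s) / q in E1 E2 *; set b := q ^+ (4 * (s + L)) / q in E2 *.
have Oa : I 0 a by apply: levMl; [apply: lev_q|case: q_unit].
have Ob : I 0 b by apply: levMl; [apply: lev_q|case: q_unit].
(* Modulo Phi_m, P = a and ab = 1, so the bracket becomes 1 - a + (1 - b) a = 1 - ab = 0. *)
have -> : 1 - a + (1 - b) * P = (1 - b) * (P - a) - (a * b - 1) by ring.
apply: levB => //; apply: levMl; first by apply: levB; [apply: lev1|].
exact: cg_trans E E1.
Qed.

(* Xw w z = (1 - a z) (1 - z / a) when w = a + 1/a - 2. *)
Definition Xw (w z : F) := (1 - z) ^+ 2 - z * w.
(** Of the four pairs (q^-1;q^2)_k/(q^2;q^2)_k, one stays undeformed in [Cf], two go into [Af] and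
    one into [Bf]. *)
Definition Cf k := \prod_(i < k) (q ^+ 7 * hf 1 i * hf c i * hf d i).
Definition Af w k := \prod_(i < k) (Xw w (x i) / Xw w (y i)).
Definition Bf b k := \prod_(i < k) hf b i.

Lemma gf_split k L : \prod_(l < L) gf 1 (k + l) =
  \prod_(l < L) (q ^+ 7 * hf 1 (k + l) * hf c (k + l) * hf d (k + l))
  * \prod_(l < L) (Xw 0 (x (k + l)) / Xw 0 (y (k + l))) * \prod_(l < L) hf 1 (k + l).
Proof.
rewrite -!big_split; apply: eq_bigr => l _ /=.
have -> : Xw 0 (x (k + l)) / Xw 0 (y (k + l)) = hf 1 (k + l) ^+ 2.
  by rewrite /hf expr_div_n /Xw !mulr0 !subr0 mul1r.
by rewrite /gf; ring.
Qed.

(** * The mixed second difference has order four *)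

Lemma lunit_oney i : (i.+1 < m)%N -> lunit I (1 - y i).
Proof. by move=> hi; apply: oney_unit; apply/negP => /dvdn_leq -/(_ isT); lia. Qed.

Lemma lunit_by b i : cg I 1 b 1 -> (i.+1 < m)%N -> lunit I (b - y i).
Proof.
move=> hb /lunit_oney /lunit_cg; apply.
by apply: cgB => //; apply: cg_refl.
Qed.

Lemma cg_Xw w z : I 2 w -> I 0 z -> cg I 2 (Xw w z) (Xw 0 z).
Proof.
move=> hw hz; rewrite /cg.
have -> : Xw w z - Xw 0 z = - (z * w) by rewrite /Xw; ring.
by apply/levN/levMl.
Qed.

Lemma lev_Xw w z : I 2 w -> I 0 z -> I 0 (Xw w z).
Proof.
by move=> hw hz; rewrite /Xw; apply: levB; [lv|apply: levMl => //; apply: lev_w hw].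
Qed.

Lemma lunit_Xw w i : I 2 w -> (i.+1 < m)%N -> lunit I (Xw w (y i)).
Proof.
move=> hw hi; apply: (@lunit_cg _ _ (Xw 0 (y i))).
  by rewrite /Xw mulr0 subr0; apply/lunitX/lunit_oney.
by apply: cg_le (cg_Xw hw (lev_y i)).
Qed.

Lemma lev_Cf k : (k < m)%N -> I 0 (Cf k).
Proof.
move=> hk; apply: (@lev_prod _ _ _ (fun i => q ^+ 7 * hf 1 i * hf c i * hf d i)) => i hi.
apply: levMl; last by apply: lev_hf; [apply: lunit_lev|apply: d_sub].
apply: levMl; last by apply: lev_hf; [apply: lunit_lev|apply: c_sub].
apply: levMl; first exact: lev_q.
by apply: lev_hf; [apply: lev1|apply: lunit_oney; lia].
Qed.

Lemma cg_Af w k : I 2 w -> (k < m)%N -> I 0 (Af 0 k) /\ cg I 2 (Af w k) (Af 0 k).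
Proof.
move=> hw hk; have h0 : I 2 (0 : F) by apply: lev0.
have h i : (i < k)%N -> I 0 (Xw 0 (x i) / Xw 0 (y i)).
  by move=> hi; apply: lev_div; [apply/lev_Xw => //; apply: lev_x|apply: lunit_Xw => //; lia].
split; first exact: (@lev_prod _ _ _ (fun i => Xw 0 (x i) / Xw 0 (y i))).
apply: (@cg_prod _ _ _ _ (fun i => Xw w (x i) / Xw w (y i))
  (fun i => Xw 0 (x i) / Xw 0 (y i))) => // i hi.
apply: cg_div; try (by apply: lunit_Xw => //; lia).
- by apply: lev_Xw => //; apply: lev_x.
- by apply: cg_Xw => //; apply: lev_x.
- by apply: cg_Xw => //; apply: lev_y.
Qed.

Lemma cg_Bf b k : cg I 1 b 1 -> (k < m)%N -> I 0 (Bf 1 k) /\ cg I 1 (Bf b k) (Bf 1 k).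
Proof.
move=> hb hk.
have h i : (i < k)%N -> I 0 (hf 1 i).
  by move=> hi; apply: lev_hf; [apply: lev1|apply: lunit_oney; lia].
split; first exact: (@lev_prod _ _ _ (hf 1)).
apply: (@cg_prod _ _ _ _ (hf b) (hf 1)) => // i hi.
have O1 := lev1 I; have Ox := lev_x i.
by apply: cg_div; try (by apply: lunit_by => //; [apply: cg_refl|lia]); 
   [lv|apply: lunit_by => //; lia|cgt..].
Qed.

(** The residue of a paired quotient does not depend on w. Hence the difference carries w (x y' -
    1), one order more than w alone. *)
Lemma cg_Xw_pair w i i' k : (2 * (i + i') + 1 = m * k)%N -> (i'.+1 < m)%N -> I 2 w ->
  cg I 3 (Xw w (x i) / Xw w (y i')) (Xw 0 (x i) / Xw 0 (y i')).
Proof.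
move=> h hi hw; have hxy := cg_xy h.
have h0 : I 2 (0 : F) by apply: lev0.
have u1 := lunit_Xw hw hi; have u2 := lunit_Xw h0 hi.
have Ox := lev_x i; have Oy := lev_y i'.
rewrite /cg.
have -> : Xw w (x i) / Xw w (y i') - Xw 0 (x i) / Xw 0 (y i') =
   w * (x i * y i' - 1) * ((x i - y i') / (Xw w (y i') * Xw 0 (y i'))).
  move: (lunit_neq0 u1) (lunit_neq0 (lunit_oney hi)); rewrite /Xw => n1 n2.
  by field; rewrite n1 n2.
apply: levMr; first exact: (@levM _ _ 2 1).
by apply: lev_div; [lv|apply: lunitM].
Qed.

Lemma cg_hf_pair b i i' k : (2 * (i + i') + 1 = m * k)%N -> (i'.+1 < m)%N -> cg I 1 b 1 ->
  cg I 2 ((1 - b * x i) / (b - y i')) ((1 - 1 * x i) / (1 - y i')).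
Proof.
move=> h hi hb; have hxy := cg_xy h.
have u1 := lunit_by hb hi; have u2 := lunit_oney hi.
rewrite /cg.
have -> : (1 - b * x i) / (b - y i') - (1 - 1 * x i) / (1 - y i') =
   (b - 1) * (x i * y i' - 1) * (((b - y i') * (1 - y i'))^-1).
  move: (lunit_neq0 u1) (lunit_neq0 u2) => n1 n2.
  by field; rewrite n1 n2.
by apply: levMr; [exact: (@levM _ _ 1 1)|case: (lunitM u1 u2)].
Qed.

Definition mixed_term w b k :=
  (1 - q ^+ (4 * k) / q) * Cf k * (Af w k - Af 0 k) * (Bf b k - Bf 1 k).

(** Passing from k to k + L multiplies [Cf], [Af], [Bf] by [rC], [rA], [rB]. The sum splits into the
    antisymmetric bracket times both differences (order 2 + 1 + 1) and into errors from the change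
    of [rA] (order 3 + 1) and of [rB] (order 2 + 2). *)
Lemma mixed_pair w b k L : I 2 w -> cg I 1 b 1 -> (2 * k + L = H)%N ->
  I 4 (mixed_term w b k + mixed_term w b (k + L)).
Proof.
move=> hw hb hk; have hH := half_mE; have h0 : I 2 (0 : F) by apply: lev0.
have k1 : (k < m)%N by lia. have k2 : (k + L < m)%N by lia.
have [OA hA] := cg_Af hw k1; have [OB hB] := cg_Bf hb k1.
have [OA2 hA2] := cg_Af hw k2; have [OB2 hB2] := cg_Bf hb k2.
have OC := lev_Cf k1; have OC2 := lev_Cf k2.
have br : I 1 (1 - q ^+ (4 * k) / q + (1 - q ^+ (4 * (k + L)) / q)
    * \prod_(l < L) gf 1 (k + l)) by apply: (@antisym_bracket 0) => //; lia.
pose rC := \prod_(l < L) (q ^+ 7 * hf 1 (k + l) * hf c (k + l) * hf d (k + l)).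
pose rA w := \prod_(l < L) (Xw w (x (k + l)) / Xw w (y (k + l))).
pose rB b := \prod_(l < L) hf b (k + l).
have EC : Cf (k + L) = Cf k * rC.
  exact: (prod_ordD (fun i => q ^+ 7 * hf 1 i * hf c i * hf d i)).
have EA v : Af v (k + L) = Af v k * rA v.
  exact: (prod_ordD (fun i => Xw v (x i) / Xw v (y i))).
have EB v : Bf v (k + L) = Bf v k * rB v by exact: (prod_ordD (hf v)).
have h1 i : (i < L)%N -> (2 * (k + i + (k + (L - i.+1))) + 1 = m * 1)%N by lia.
have OrA : I 0 (rA 0).
  apply: (@lev_prod _ _ _ (fun l => Xw 0 (x (k + l)) / Xw 0 (y (k + l)))) => i hi.
  by apply: lev_div; [apply/lev_Xw => //; apply: lev_x|apply: lunit_Xw => //; lia].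
have OrB : I 0 (rB 1).
  apply: (@lev_prod _ _ _ (fun l => hf 1 (k + l))) => i hi.
  by apply: lev_hf; [apply: lev1|apply: lunit_oney; lia].
have OrC : I 0 rC.
  apply: (@lev_prod _ _ _ (fun l =>
    q ^+ 7 * hf 1 (k + l) * hf c (k + l) * hf d (k + l))) => i hi.
  apply: levMl; last by apply: lev_hf; [apply: lunit_lev|apply: d_sub].
  apply: levMl; last by apply: lev_hf; [apply: lunit_lev|apply: c_sub].
  apply: levMl; first exact: lev_q.
  by apply: lev_hf; [apply: lev1|apply: lunit_oney; lia].
have hrA : cg I 3 (rA w) (rA 0).
  rewrite /rA (prod_ratio_rev (fun i => Xw w (x i)) (fun i => Xw w (y i))).
  rewrite (prod_ratio_rev (fun i => Xw 0 (x i)) (fun i => Xw 0 (y i))).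
  apply: (@cg_prod _ _ _ _
    (fun l => Xw w (x (k + l)) / Xw w (y (k + (L - l.+1))))
    (fun l => Xw 0 (x (k + l)) / Xw 0 (y (k + (L - l.+1))))) => i hi.
    by apply: lev_div; [apply/lev_Xw => //; apply: lev_x|apply: lunit_Xw => //; lia].
  by apply: (cg_Xw_pair (h1 _ hi)) => //; lia.
have hrB : cg I 2 (rB b) (rB 1).
  rewrite /rB (prod_ratio_rev (fun i => 1 - b * x i) (fun i => b - y i)).
  rewrite (prod_ratio_rev (fun i => 1 - 1 * x i) (fun i => 1 - y i)).
  apply: (@cg_prod _ _ _ _
    (fun l => (1 - b * x (k + l)) / (b - y (k + (L - l.+1))))
    (fun l => (1 - 1 * x (k + l)) / (1 - y (k + (L - l.+1))))) => i hi.
    have O1 := lev1 I; have Ox := lev_x (k + i).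
    by apply: lev_div; [lv|apply: lunit_oney; lia].
  by apply: (cg_hf_pair (h1 _ hi)) => //; lia.
have Oc2 : I 0 (1 - q ^+ (4 * (k + L)) / q).
  by apply: levB; [apply: lev1|apply: lev_div => //; apply: lev_q].
have OAw := cg_lev hA OA; have OBb := cg_lev hB OB.
move: br; rewrite gf_split -/rC -/(rA 0) -/(rB 1) => br.
have -> : mixed_term w b k + mixed_term w b (k + L) =
  Cf k * ((Af w k - Af 0 k) * (Bf b k - Bf 1 k)
    * (1 - q ^+ (4 * k) / q + (1 - q ^+ (4 * (k + L)) / q) * (rC * rA 0 * rB 1)))
  + Cf k * (1 - q ^+ (4 * (k + L)) / q) * rC * Af w k *
      ((rA w - rA 0) * (Bf b (k + L) - Bf 1 (k + L)))
  + Cf k * (1 - q ^+ (4 * (k + L)) / q) * rC * rA 0 * Bf b k *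
      ((Af w k - Af 0 k) * (rB b - rB 1)).
  by rewrite /mixed_term EC !EA !EB; ring.
apply: levD; first apply: levD.
- by apply: levMl => //; apply: (@levM _ _ 3 1) => //; apply: (@levM _ _ 2 1).
- apply: levMl; first by lv.
  exact: (@levM _ _ 3 1).
- apply: levMl; first by lv.
  exact: (@levM _ _ 2 2).
Qed.

(** Twice the sum is a sum over symmetric pairs, and 2 is a unit; a fixed point k = h - k thus needs
    no separate treatment. *)
Lemma lev_double_sum e h (f : nat -> F) :
  (forall k, (k <= h)%N -> I e (f k + f (h - k)%N)) -> I e (\sum_(k < h.+1) f k).
Proof.
move=> hf.
have E : 2%:R * (\sum_(k < h.+1) f k) = \sum_(k < h.+1) (f k + f (h - k)%N).
  rewrite big_split /= [X in _ = _ + X](reindex_inj rev_ord_inj) /=.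
  rewrite mulr_natl mulr2n; congr (_ + _); apply: eq_bigr => i _.
  by rewrite subSS subKn // -ltnS.
have [n0 _ hV] := nat_unit 1.
rewrite -[X in I e X](mulKf n0) E; apply: levMl => //.
by apply: (@lev_sum _ _ _ _ (fun k => f k + f (h - k)%N)) => k hk; apply: hf.
Qed.

Lemma lev_xH : I 1 (1 - x H).
Proof.
have -> : x H = q ^+ m.
  by rewrite /oddq half_mE exprSr mulfK // q_neq0.
exact: cg_sym qm1.
Qed.

Lemma mixed_sum w b M : I 2 w -> cg I 1 b 1 -> (H <= M < m)%N ->
  I 4 (\sum_(k < M.+1) mixed_term w b k).
Proof.
move=> hw hb /andP [h1 h2]; have hH := half_mE.
have -> : M.+1 = (H.+1 + (M - H))%N by lia.
rewrite sum_ordD; apply: levD.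
  apply: lev_double_sum => k hk.
  case: (leqP (2 * k) H) => hkH.
    have -> : (H - k = k + (H - 2 * k))%N by lia.
    by apply: mixed_pair => //; lia.
  have {1}-> : k = (H - k + (2 * k - H))%N by lia.
  by rewrite addrC; apply: mixed_pair => //; lia.
(* Beyond H the two differences give order 3; the fourth is the factor 1 - x_H = 1 - q^m contained
   in [Cf]. *)
apply: (@lev_sum _ _ _ _ (fun i => mixed_term w b (H.+1 + i))) => i hi.
have hk : (H.+1 + i < m)%N by lia.
have [OA hA] := cg_Af hw hk; have [OB hB] := cg_Bf hb hk.
apply: (@levM _ _ 3 1) => //; apply: (@levM _ _ 1 2) => //; apply: levMl.
  by apply: levB; [apply: lev1|apply: lev_div => //; apply: lev_q].
rewrite /Cf (prod_ordD (fun i => q ^+ 7 * hf 1 i * hf c i * hf d i)).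
rewrite big_ord_recr /=; apply: levMr.
  apply: levMl; first by apply: lev_Cf; lia.
  apply: levMr; last by apply: lev_hf; [apply: lunit_lev|apply: d_sub].
  apply: levMr; last by apply: lev_hf; [apply: lunit_lev|apply: c_sub].
  apply: levMl; first exact: lev_q.
  by apply: lev_div; [rewrite mul1r; apply: lev_xH|apply: lunit_oney; lia].
apply: (@lev_prod _ _ _ (fun l =>
    q ^+ 7 * hf 1 (H.+1 + l) * hf c (H.+1 + l) * hf d (H.+1 + l))) => l hl.
apply: levMl; last by apply: lev_hf; [apply: lunit_lev|apply: d_sub].
apply: levMl; last by apply: lev_hf; [apply: lunit_lev|apply: c_sub].
apply: levMl; first exact: lev_q.
by apply: lev_hf; [apply: lev1|apply: lunit_oney; lia].
Qed.

(** * Orders of q-shifted factorials at Phi_m *)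

Lemma lev_exp e k z : I e z -> I (e * k)%N (z ^+ k).
Proof.
move=> hz; elim: k => [|k IH]; first by rewrite muln0 expr0; apply: lev1.
by rewrite exprS mulnS; apply: levM.
Qed.

(** The cofactor is a geometric sum of a terms, each congruent to 1, hence congruent to the unit
    a. *)
Lemma qm_multiple a : (0 < a)%N ->
  exists2 v, lunit I v & 1 - q ^+ (m * a) = v * (1 - q ^+ m).
Proof.
case: a => // a _; exists (\sum_(i < a.+1) q ^+ m ^+ i).
  apply: (lunit_cg (nat_unit a)).
  have -> : a.+1%:R = \sum_(i < a.+1) 1 :> F by rewrite sumr_const card_ord.
  apply: (@cg_sum _ _ _ _ (fun i => q ^+ m ^+ i) (fun => 1)) => i _.
  by rewrite -exprM; apply: cg_qm.
by rewrite exprM -opprB subrX1; ring.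
Qed.

(** The exponent counts the i < k with m | 2i - 1, that is, i congruent to H modulo m; the offset
    reflects H = m - 1 - (m-3)/2. *)
Lemma odd_prod k : exists2 v, lunit I v &
  \prod_(i < k) (1 - x i) = v * (1 - q ^+ m) ^+ ((k + half (m - 3)) %/ m).
Proof.
have q0 := q_neq0; set h := half _.
have hm : (2 * h + 3 = m)%N by rewrite /h; lia.
elim: k => [|k [v hv IH]].
  by exists 1; rewrite ?big_ord0 ?divn_small ?expr0 ?mulr1 //; [apply: lunit1|lia].
rewrite big_ord_recr /= IH addSn divnS; last by lia.
case: (boolP (m %| (k + h).+1)%N) => dv; rewrite /= ?add1n ?add0n.
  have k0 : (0 < k)%N by case: k dv {IH} => // /dvdn_leq -/(_ isT); lia.
  have [a ea] := dvdnP dv.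
  have [v' hv' E] : exists2 v, lunit I v & 1 - q ^+ (m * (2 * a - 1)) = v * (1 - q ^+ m).
    by apply: qm_multiple; case: (posnP a) ea => [->|]; lia.
  exists (v * v'); first exact: lunitM.
  have -> : x k = q ^+ (m * (2 * a - 1)).
    apply: (mulIf q0); rewrite /oddq divfK // -exprSr; congr (_ ^+ _).
    by rewrite mulnBr; nia.
  by rewrite E exprS; ring.
exists (v * (1 - x k)); last by ring.
apply: lunitM => //; case: k dv {IH} => [|k] dv.
  have -> : 1 - x 0 = - ((1 - q ^+ 1) / q) by rewrite /oddq muln0 expr0 expr1; field.
  apply/lunitN/lunitM; last exact: lunitV.
  by apply: q_sub1; rewrite dvdn1; lia.
have -> : x k.+1 = q ^+ (2 * k + 1).
  have E2 : (2 * k.+1 = (2 * k + 1).+1)%N by lia.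
  by rewrite /oddq E2 exprSr mulfK.
apply: q_sub1; apply: contra dv => dv.
have : (m %| 2 * (k.+1 + h).+1)%N.
  have -> : (2 * (k.+1 + h).+1 = 2 * k + 1 + m)%N by lia.
  by rewrite dvdn_addr.
by rewrite Gauss_dvdr // coprimen2.
Qed.

Lemma even_prod k : exists2 v, lunit I v &
  \prod_(i < k) (1 - y i) = v * (1 - q ^+ m) ^+ (k %/ m).
Proof.
elim: k => [|k [v hv IH]].
  by exists 1; rewrite ?big_ord0 ?div0n ?expr0 ?mulr1 //; apply: lunit1.
rewrite big_ord_recr /= IH divnS; last by lia.
case: (boolP (m %| k.+1)%N) => dv; rewrite /= ?add1n ?add0n.
  have [a ea] := dvdnP dv.
  have [v' hv' E] : exists2 v, lunit I v & 1 - q ^+ (m * (2 * a)) = v * (1 - q ^+ m).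
    by apply: qm_multiple; case: (posnP a) ea => [->|]; lia.
  exists (v * v'); first exact: lunitM.
  have -> : y k = q ^+ (m * (2 * a)) by congr (_ ^+ _); lia.
  by rewrite E exprS; ring.
by exists (v * (1 - y k)); [apply: lunitM => //; apply: oney_unit|ring].
Qed.

Lemma leq_divD k h : (k %/ m <= (k + h) %/ m)%N.
Proof. by rewrite leq_div2r // leq_addr. Qed.

Lemma q_sub1m_neq0 : 1 - q ^+ m != 0. Proof. by apply: q_neq1; lia. Qed.

(** In each block of m factors the numerator vanishes at index H and the denominator only at index m
    - 1. The quotient therefore stays integral for every k, and it has order one when k modulo m
    exceeds H. *)
Lemma lev_hf1_prod k :
  I ((k + half (m - 3)) %/ m - k %/ m)%N (\prod_(i < k) hf 1 i).
Proof.
have [v hv E] := odd_prod k; have [v' hv' E'] := even_prod k.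
have -> : \prod_(i < k) hf 1 i = \prod_(i < k) (1 - x i) / \prod_(i < k) (1 - y i).
  by rewrite -prodf_div; apply: eq_bigr => i _; rewrite /hf mul1r.
rewrite E E' -mulf_div.
have -> : (1 - q ^+ m) ^+ ((k + half (m - 3)) %/ m) / (1 - q ^+ m) ^+ (k %/ m) =
    (1 - q ^+ m) ^+ ((k + half (m - 3)) %/ m - k %/ m).
  by rewrite expfB_cond // (negPf q_sub1m_neq0) add0n leq_divD.
apply: levMl; first by apply: lev_div => //; apply: lunit_lev.
by rewrite -[X in I X _]mul1n; apply/lev_exp/cg_sym.
Qed.

Lemma lev_gf_prod e k :
  (e <= (k + half (m - 3)) %/ m - k %/ m)%N -> I e (\prod_(i < k) gf 1 i).
Proof.
move=> he.
have h1 : I e (\prod_(i < k) hf 1 i) by apply: lev_leq he (lev_hf1_prod k).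
have -> : \prod_(l < k) gf 1 l = \prod_(l < k) q ^+ 7
      * (\prod_(l < k) hf 1 l) ^+ 3 * \prod_(l < k) hf c l * \prod_(l < k) hf d l
      * \prod_(l < k) hf 1 l.
  by rewrite -prodrXl -!big_split; apply: eq_bigr => i _; rewrite /gf /=; ring.
apply: levMl => //; have h0 := lev_w h1.
have h7 := lev_q 7; have hc : I 0 (\prod_(l < k) hf c l).
  by apply: (@lev_prod _ _ _ (hf c)) => i _; apply: lev_hf; [apply: lunit_lev|apply: c_sub].
have hd : I 0 (\prod_(l < k) hf d l).
  by apply: (@lev_prod _ _ _ (hf d)) => i _; apply: lev_hf; [apply: lunit_lev|apply: d_sub].
by rewrite prodr_const; lv.
Qed.

(** * Proper divisors: sums over blocks of m terms *)

Definition lhs_term k := (1 - q ^+ (4 * k) / q) * \prod_(i < k) gf 1 i.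

Lemma lev_lhs_coef k : I 0 (1 - q ^+ (4 * k) / q).
Proof. by apply: levB; [apply: lev1|apply: lev_div => //; apply: lev_q]. Qed.

Lemma lhs_pair B r L : (m %| B)%N -> (2 * r + L = H)%N ->
  I 1 (lhs_term (B + r) + lhs_term (B + (r + L))).
Proof.
move=> dB hr; rewrite addnA /lhs_term [in X in _ + X]prod_ordD mulrCA.
rewrite [X in X + _]mulrC -mulrDr; apply: levMl; first exact: lev_gf_prod.
by apply: (antisym_bracket dB); [lia|rewrite leq_addr].
Qed.

(** The terms with r <= H cancel in pairs. For H < r < m each term vanishes by itself: the zero at H
    is not compensated before the block ends. *)
Lemma lhs_block B L : (m %| B)%N -> (H < L <= m)%N ->
  I 1 (\sum_(r < L) lhs_term (B + r)).
Proof.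
move=> dB /andP [h1 h2]; have hH := half_mE.
have -> : L = (H.+1 + (L - H.+1))%N by lia.
rewrite (sum_ordD (fun r => lhs_term (B + r))); apply: levD.
  apply: (@lev_double_sum _ _ (fun r => lhs_term (B + r))) => k hk.
  case: (leqP (2 * k) H) => hkH.
    have -> : (H - k = k + (H - 2 * k))%N by lia.
    by apply: lhs_pair => //; lia.
  have {1}-> : k = (H - k + (2 * k - H))%N by lia.
  by rewrite addrC; apply: lhs_pair => //; lia.
apply: (@lev_sum _ _ _ _ (fun i => lhs_term (B + (H.+1 + i)))) => i hi.
apply: levMl; first exact: lev_lhs_coef.
apply: lev_gf_prod; have [a ->] := dvdnP dB.
have m0 : (0 < m)%N by lia.
rewrite -addnA !divnMDl // [((H.+1 + i) %/ m)%N]divn_small; last by lia.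
by rewrite addn0 -addnBAC // subnn add0n divn_gt0 //; lia.
Qed.

Lemma lhs_sum a L : (H < L <= m)%N -> I 1 (\sum_(k < m * a + L) lhs_term k).
Proof.
move=> hL; have hH := half_mE; rewrite sum_ordD; apply: levD; last first.
  by apply: lhs_block => //; apply: dvdn_mulr.
elim: a => [|a IH]; first by rewrite muln0 big_ord0; apply: lev0.
rewrite mulnS addnC sum_ordD; apply: levD => //.
by apply: lhs_block; [apply: dvdn_mulr|rewrite leqnn andbT; lia].
Qed.

(** Counting zeros: (q^3;q^2)_k has at least the order of (q^2;q^2)_k and of (q^6;q^2)_k, so its
    cube covers their product. *)
Lemma rhs_term_lev k :
  I 0 (poch (q ^+ 2) (q ^+ 3) k ^+ 3 / (poch (q ^+ 2) (q ^+ 2) k * poch (q ^+ 2) (q ^+ 6) k)).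
Proof.
have q0 := q_neq0; have hm : (2 < m)%N by lia.
(* As x_2 = q^3 and y_2 = q^6, the factorials starting there are tails of products with k + 2
   factors, whose first two factors are units. *)
have [v hv E] := odd_prod k.+2; have [v' hv' E'] := even_prod k.
have [v2 hv2 E2] := even_prod k.+2.
have Eo : poch (q ^+ 2) (q ^+ 3) k = \prod_(i < k) (1 - x (2 + i)).
  apply: eq_bigr => i _; congr (1 - _); apply: (mulIf q0).
  by rewrite /oddq divfK // -exprM -exprD -exprSr; congr (_ ^+ _); lia.
have Ee : poch (q ^+ 2) (q ^+ 2) k = \prod_(i < k) (1 - y i).
  by apply: eq_bigr => i _; congr (1 - _); rewrite -exprM -exprD; congr (_ ^+ _); lia.
have E6 : poch (q ^+ 2) (q ^+ 6) k = \prod_(i < k) (1 - y (2 + i)).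
  by apply: eq_bigr => i _; congr (1 - _); rewrite -exprM -exprD; congr (_ ^+ _); lia.
have s2 : (k.+2 = 2 + k)%N by [].
rewrite s2 (prod_ordD (fun i => 1 - x i)) -Eo in E.
rewrite s2 (prod_ordD (fun i => 1 - y i)) -E6 in E2; rewrite -Ee in E'.
have ux0 : lunit I (1 - x 0).
  have -> : 1 - x 0 = - ((1 - q ^+ 1) / q) by rewrite /oddq muln0 expr0 expr1; field.
  by apply/lunitN/lunitM; [apply: q_sub1; rewrite dvdn1; lia|exact: lunitV].
have ux1 : lunit I (1 - x 1).
  have -> : x 1 = q ^+ 1 by rewrite /oddq; field.
  by apply: q_sub1; rewrite dvdn1; lia.
have u3 : lunit I (\prod_(i < 2) (1 - x i)).
  by rewrite !big_ord_recl big_ord0 mulr1; apply: lunitM.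
have u6 : lunit I (\prod_(i < 2) (1 - y i)).
  apply: (@lunit_prod _ _ 2 (fun i => 1 - y i)) => i hi.
  by apply: lunit_oney; lia.
set z := ((_ + _) %/ m)%N in E; set t := 1 - q ^+ m in E E' E2.
have t0 : t != 0 := q_sub1m_neq0.
have {}E : poch (q ^+ 2) (q ^+ 3) k = v / (\prod_(i < 2) (1 - x i)) * t ^+ z.
  by rewrite mulrAC -E mulrC mulKf // (lunit_neq0 u3).
have {}E2 : poch (q ^+ 2) (q ^+ 6) k =
     v2 / (\prod_(i < 2) (1 - y i)) * t ^+ ((2 + k) %/ m).
  by rewrite mulrAC -E2 mulrC mulKf // (lunit_neq0 u6).
rewrite E E' E2.
have hz : ((k %/ m) + ((2 + k) %/ m) <= z * 3)%N.
  have h1 : (k %/ m <= z)%N by apply: leq_trans (leq_div2r _ _) (leq_divD _ _); lia.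
  by have h2 : ((2 + k) %/ m <= z)%N := leq_divD _ _; lia.
have -> : (v / \prod_(i < 2) (1 - x i) * t ^+ z) ^+ 3 /
  (v' * t ^+ (k %/ m) * (v2 / \prod_(i < 2) (1 - y i) * t ^+ ((2 + k) %/ m))) =
  (v / \prod_(i < 2) (1 - x i)) ^+ 3 / (v' * (v2 / \prod_(i < 2) (1 - y i)))
  * t ^+ (z * 3 - (k %/ m + (2 + k) %/ m)).
  rewrite expfB_cond ?(negPf t0) // exprD exprM.
  by field; rewrite !expf_neq0 // (lunit_neq0 u3) (lunit_neq0 u6) (lunit_neq0 hv')
    (lunit_neq0 hv2).
apply: levMl; first apply: lev_div; first apply/levX/lev_div => //.
- exact: lunit_lev.
- by apply: lunitM => //; apply: lunitM => //; apply: lunitV.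
- by apply: levX; apply: levB; [apply: lev1|apply: lev_q].
Qed.

(** * Coefficients of the balanced sums *)

Notation P := (poch (q ^+ 2)).
Notation u := (q ^+ m).

(* watson_coef for the base q^2 and the parameters a = 1/q, d = dl/q, e = ep/q. *)
Definition Uc (dl ep : F) j :=
  P q^-1 H.+1 * P (dl / q) j * P (ep / q) j / (P (q ^+ 2 / dl) H * P (q ^+ 2 / ep) H)
  * P (q ^+ 3 / (dl * ep)) (H - j) * (q ^+ 3 / (dl * ep)) ^+ j
  * \prod_(i < j) (- (q ^+ 2 ^+ i / q ^+ 2 ^+ j)) * fallp (q ^+ 2) H j.

Lemma p_H : q ^+ 2 ^+ H = u * q.
Proof. by rewrite -exprM half_mE exprSr. Qed.

Lemma u_neq0 : u != 0. Proof. by rewrite expf_neq0 ?q_neq0. Qed.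

Lemma lev_u : I 0 u. Proof. exact: lev_q. Qed.

Lemma lunit_u : lunit I u. Proof. exact: lunitX. Qed.

Definition w0 := (1 - u) ^+ 2 / u.

Lemma lev_w0 : I 2 w0.
Proof.
by apply: lev_div; [apply: (@levM _ _ 1 1); apply: cg_sym|exact: lunit_u].
Qed.

Lemma H_ge2 : (2 <= H)%N. Proof. by have := half_mE; lia. Qed.

Lemma Uc_rec dl ep j : dl != 0 -> ep != 0 -> (j < H)%N ->
  Uc dl ep j.+1 * (1 - q ^+ 3 / (dl * ep) * q ^+ 2 ^+ (H - j.+1)) =
  - (Uc dl ep j * (1 - dl / q * q ^+ 2 ^+ j) * (1 - ep / q * q ^+ 2 ^+ j)
   * (q ^+ 3 / (dl * ep)) / q ^+ 2 ^+ j.+1 * (u * q - q ^+ 2 ^+ j)).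
Proof.
move=> dl0 ep0 hj; rewrite /Uc.
have -> : (H - j = (H - j.+1).+1)%N by lia.
have -> : \prod_(i < j.+1) (- (q ^+ 2 ^+ i / q ^+ 2 ^+ j.+1)) =
   - (\prod_(i < j) (- (q ^+ 2 ^+ i / q ^+ 2 ^+ j)) / q ^+ 2 ^+ j.+1).
  have q0 k : q ^+ 2 ^+ k != 0 by rewrite !expf_neq0 // q_neq0.
  rewrite big_ord_recr /=.
  have -> : \prod_(i < j) (- (q ^+ 2 ^+ i / q ^+ 2 ^+ j.+1)) =
    \prod_(i < j) (- (q ^+ 2 ^+ i / q ^+ 2 ^+ j)) / q ^+ 2 ^+ j.
    have E : (q ^+ 2 ^+ j)^-1 = \prod_(i < j) (q ^+ 2)^-1.
      by rewrite prodr_const card_ord exprVn.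
    rewrite [X in _ = _ * X]E -big_split; apply: eq_bigr => i _ /=.
    rewrite (exprSr (q ^+ 2)).
    by field; rewrite q0 q_neq0.
  by field; rewrite !q0.
rewrite !pochS fallpS p_H [(q ^+ 3 / (dl * ep)) ^+ j.+1]exprS.
move: (\prod_(i < j) _) (fallp _ _ _) => ? ?; ring.
Qed.

Lemma odd_poch k : \prod_(i < k) (1 - x i) = P q^-1 k.
Proof.
by apply: eq_bigr => i _; rewrite /oddq -exprM mulrC.
Qed.

Lemma even_poch k : \prod_(i < k) (1 - y i) = P (q ^+ 2) k.
Proof.
by apply: eq_bigr => i _; rewrite /evenq addnC exprD -exprM.
Qed.

Definition UcA_ratio k := Xw w0 (x (2 + k)) * (1 - x (2 + k)) / (1 - y k).

Lemma Xw_w0 z : Xw w0 z = (1 - u * z) * (1 - z / u).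
Proof. by rewrite /Xw /w0; field; rewrite u_neq0. Qed.

Lemma x2E k : x (2 + k) = q ^+ (2 * k + 3).
Proof.
apply: (mulIf q_neq0); rewrite /oddq divfK ?q_neq0 // -exprSr.
by congr (_ ^+ _); lia.
Qed.

Lemma Uc_stepA k : (k.+2 < H)%N -> Uc u 1 k.+3 = Uc u 1 k.+2 * UcA_ratio k.
Proof.
move=> hk; have q0 := q_neq0; have hH := half_mE.
have := @Uc_rec u 1 k.+2 u_neq0 (oner_neq0 _) hk.
have n1 : 1 - y k != 0 by apply: q_neq1; lia.
have y0 : y k != 0 by rewrite expf_neq0.
have -> : q ^+ 3 / (u * 1) * q ^+ 2 ^+ (H - k.+3) = (y k)^-1.
  have -> : u = q ^+ 3 * q ^+ 2 ^+ (H - k.+3) * y k.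
    by rewrite /evenq -exprM -!exprD; congr (_ ^+ _); lia.
  by field; rewrite y0 ?expf_neq0.
have -> : q ^+ 2 ^+ k.+2 = q * x (2 + k).
  by rewrite x2E -exprM -exprS; congr (_ ^+ _); lia.
have -> : q ^+ 2 ^+ k.+3 = q ^+ 4 * y k.
  by rewrite /evenq -exprM -exprD; congr (_ ^+ _); lia.
rewrite /UcA_ratio Xw_w0.
have n2 : 1 - (y k)^-1 != 0.
  by have -> : 1 - (y k)^-1 = - ((1 - y k) / y k) by [field|]; rewrite oppr_eq0 mulf_neq0 ?invr_eq0.
move=> E; apply: (mulIf n2); rewrite E.
by field; rewrite ?u_neq0 ?n1 ?q0 ?y0.
Qed.

(** For w of order two, this ratio and [UcA_ratio] both reduce modulo Phi_m to (1 - x_(2+k))^3/(1 -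
    y_k), the matching ratio in the right-hand sum. *)
Definition Ucw_ratio w k := Xw w (x (2 + k)) * ((u - x (2 + k)) / (u - y k)).

Lemma Uc_stepw dl k : dl != 0 -> (k.+2 < H)%N ->
  Uc dl dl^-1 k.+3 = Uc dl dl^-1 k.+2 * Ucw_ratio ((1 - dl) ^+ 2 / dl) k.
Proof.
move=> dl0 hk; have q0 := q_neq0; have hH := half_mE.
have := @Uc_rec dl dl^-1 k.+2 dl0 (invr_neq0 dl0) hk.
have y0 : y k != 0 by rewrite expf_neq0.
have n1 : u - y k != 0.
  have -> : u = y k * q ^+ (m - (2 * k + 2)).
    by rewrite /evenq -exprD; congr (_ ^+ _); lia.
  rewrite -[X in _ - X]mulr1 -mulrBr mulf_neq0 // -opprB oppr_eq0 q_neq1 //; lia.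
rewrite divff // divr1.
have -> : q ^+ 3 * q ^+ 2 ^+ (H - k.+3) = u / y k.
  apply: (canRL (mulfK y0)).
  by rewrite /evenq -exprM -!exprD; congr (_ ^+ _); lia.
have -> : q ^+ 2 ^+ k.+2 = q * x (2 + k).
  by rewrite x2E -exprM -exprS; congr (_ ^+ _); lia.
have -> : q ^+ 2 ^+ k.+3 = q ^+ 4 * y k.
  by rewrite /evenq -exprM -exprD; congr (_ ^+ _); lia.
rewrite /Ucw_ratio /Xw.
have n2 : 1 - u / y k != 0.
  have -> : 1 - u / y k = - ((u - y k) / y k) by field.
  by rewrite oppr_eq0 mulf_neq0 ?invr_eq0.
move=> E; apply: (mulIf n2); rewrite E.
by field; rewrite dl0 n1 q0 y0.
Qed.

Lemma UcA_closed k : (k.+2 <= H)%N -> Uc u 1 k.+2 = Uc u 1 2 * \prod_(i < k) UcA_ratio i.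
Proof.
elim: k => [|k IH] hk; first by rewrite big_ord0 mulr1.
by rewrite Uc_stepA // IH 1?ltnW // big_ord_recr /= mulrA.
Qed.

Lemma Ucw_closed dl k : dl != 0 -> (k.+2 <= H)%N ->
  Uc dl dl^-1 k.+2 = Uc dl dl^-1 2 * \prod_(i < k) Ucw_ratio ((1 - dl) ^+ 2 / dl) i.
Proof.
move=> dl0; elim: k => [|k IH] hk; first by rewrite big_ord0 mulr1.
by rewrite Uc_stepw // IH 1?ltnW // big_ord_recr /= mulrA.
Qed.

Lemma poch_rev z k : P z k = \prod_(i < k) (1 - z * q ^+ 2 ^+ (k - i.+1)).
Proof. by rewrite /poch (reindex_inj rev_ord_inj). Qed.

(** Since u is a power of q, reversing the factorials that contain u makes all long products cancel;
    only boundary factors remain. *)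
Lemma UcA2 : Uc u 1 2 =
  (1 - u) * q ^+ (H - 2) * (1 - q^-1) * (1 - q) / u ^+ 2 * (u * q - 1) * (u * q - q ^+ 2).
Proof.
have q0 := q_neq0; have u0 := u_neq0; have hH := half_mE.
pose h := (H - 2)%N; have Hh : (H = 2 + h)%N by have := H_ge2; rewrite /h; lia.
have pk k : q ^+ 2 ^+ k != 0 by rewrite !expf_neq0.
have E1 : P q^-1 H.+1 = P q^-1 H * (1 - u).
  by rewrite pochS p_H; congr (_ * (1 - _)); field.
have E2 : P (q ^+ 2 / u) H = \prod_(i < H) (- (q / q ^+ 2 ^+ i)) * P q^-1 H.
  rewrite poch_rev -big_split; apply: eq_bigr => i _ /=.
  have -> : u = q ^+ 2 ^+ (H - i.+1) * q * q ^+ 2 ^+ i.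
    by rewrite -!exprM -exprSr -exprD; congr (_ ^+ _); have := ltn_ord i; lia.
  by field; rewrite q0 !pk.
have E3 : P (q ^+ 3 / u) h =
    \prod_(i < h) (- (q ^+ 2 * q ^+ 2 ^+ i)^-1) * P (q ^+ 2) h.
  rewrite poch_rev -big_split; apply: eq_bigr => i _ /=.
  have -> : u = q ^+ 2 ^+ (h - i.+1) * q ^+ 5 * q ^+ 2 ^+ i.
    by rewrite -!exprM -!exprD; congr (_ ^+ _); have := ltn_ord i; lia.
  by field; rewrite q0 !pk.
have E4 : P (q ^+ 2) H = P (q ^+ 2) h * (1 - u / q) * (1 - u * q).
  rewrite Hh addnC addn2 !pochS; congr (_ * (1 - _) * (1 - _)).
    apply: (canRL (mulfK q0)); rewrite -exprM -exprD -exprSr.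
    by congr (_ ^+ _); lia.
  by rewrite -exprM -exprD -exprSr; congr (_ ^+ _); lia.
have E5 : \prod_(i < H) (- (q / q ^+ 2 ^+ i)) = 
    \prod_(i < h) (- (q / (q ^+ 2 ^+ 2 * q ^+ 2 ^+ i))).
  rewrite Hh (prod_ordD (fun i => - (q / q ^+ 2 ^+ i))) !big_ord_recl big_ord0 /=.
  rewrite -[RHS]mul1r; congr (_ * _); first by rewrite /bump /=; field; rewrite ?oner_neq0 ?q0.
  by apply: eq_bigr => i _; rewrite exprD.
have E6 : \prod_(i < h) (- (q ^+ 2 * q ^+ 2 ^+ i)^-1) = q ^+ h *
    \prod_(i < h) (- (q / (q ^+ 2 ^+ 2 * q ^+ 2 ^+ i))).
  have -> : q ^+ h = \prod_(i < h) q by rewrite prodr_const card_ord.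
  by rewrite -big_split; apply: eq_bigr => i _ /=; field; rewrite q0 pk.
have n1 : P q^-1 H != 0.
  apply: poch_neq0 => i; rewrite -exprM; case: i => [|i].
    by have -> : 1 - q^-1 * q ^+ (2 * 0) = - (1 - q ^+ 1) / q; [field|
      rewrite mulf_neq0 ?invr_eq0 // oppr_eq0 q_neq1].
  have -> : q^-1 * q ^+ (2 * i.+1) = q ^+ (2 * i + 1).
    by apply: (canLR (mulKf q0)); rewrite -exprS; congr (_ ^+ _); lia.
  by rewrite q_neq1 // addn1.
have n2 : P (q ^+ 2) h != 0.
  by apply: poch_neq0 => i; rewrite -exprM -exprD q_neq1.
have n3 : \prod_(i < h) (- (q / (q ^+ 2 ^+ 2 * q ^+ 2 ^+ i))) != 0.
  by apply/prodf_neq0 => i _; rewrite oppr_eq0 mulf_neq0 ?invr_eq0 // mulf_neq0 // expf_neq0 ?expf_neq0.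
have n4 : q - u != 0.
  have -> : u = q * q ^+ m.-1 by rewrite -exprS; congr (_ ^+ _); lia.
  by rewrite -[X in X - _]mulr1 -mulrBr mulf_neq0 // q_neq1 //; lia.
have n5 : 1 - u * q != 0 by rewrite -exprSr q_neq1.
rewrite /Uc -/h mulr1 E1 E2 divr1 E4 E3 E5 E6 /fallp.
rewrite !big_ord_recl !big_ord0 p_H /bump /= !pochS !poch0.
by field; rewrite u0 q0 n1 n2 n3 n4 n5.
Qed.

Definition Kj j := P q^-1 H.+1 * P (q ^+ 3) (H - j) * q ^+ 3 ^+ j
  * \prod_(i < j) (- (q ^+ 2 ^+ i / q ^+ 2 ^+ j)) * fallp (q ^+ 2) H j.

Lemma Uc_inv dl j : dl != 0 -> Uc dl dl^-1 j =
  Kj j * (\prod_(i < j) Xw ((1 - dl) ^+ 2 / dl) (x i)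
          / \prod_(i < H) Xw ((1 - dl) ^+ 2 / dl) (y i)).
Proof.
move=> dl0; have q0 := q_neq0.
have -> : \prod_(i < j) Xw ((1 - dl) ^+ 2 / dl) (x i) = P (dl / q) j * P (dl^-1 / q) j.
  rewrite -big_split; apply: eq_bigr => i _ /=.
  by rewrite /Xw /oddq -exprM; field; rewrite dl0 q0.
have -> : \prod_(i < H) Xw ((1 - dl) ^+ 2 / dl) (y i) =
    P (q ^+ 2 / dl) H * P (q ^+ 2 / dl^-1) H.
  rewrite -big_split; apply: eq_bigr => i _ /=.
  by rewrite /Xw /evenq addnC exprD -exprM; field; rewrite dl0 oner_neq0.
by rewrite /Uc /Kj divff // divr1; ring.
Qed.

Lemma lev_poch a k : I 0 a -> I 0 (P a k).
Proof.
move=> ha; apply: (@lev_prod _ _ _ (fun i => 1 - a * q ^+ 2 ^+ i)) => i _.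
by have O1 := lev1 I; have Oq := lev_q 2; lv.
Qed.

Lemma cg_poch e a b k : I 0 b -> cg I e a b -> cg I e (P a k) (P b k).
Proof.
move=> hb h; have O1 := lev1 I; have Oq := lev_q 2.
apply: (@cg_prod _ _ _ _ (fun i => 1 - a * q ^+ 2 ^+ i)
  (fun i => 1 - b * q ^+ 2 ^+ i)) => i _; first by lv.
by cgt.
Qed.

Lemma lev_poch_qV : I 1 (P q^-1 H.+1).
Proof.
rewrite -odd_poch big_ord_recr /= odd_poch; apply: levMl; last exact: lev_xH.
by apply: lev_poch; case: q_unit.
Qed.

Lemma lev_flip j : I 0 (\prod_(i < j) (- (q ^+ 2 ^+ i / q ^+ 2 ^+ j))).
Proof.
apply: (@lev_prod _ _ _ (fun i => - (q ^+ 2 ^+ i / q ^+ 2 ^+ j))) => i _.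
by rewrite -!exprM; apply/levN/levMl; [apply: lev_q|apply: lev_qV].
Qed.

Lemma lev_fallp j : I 0 (fallp (q ^+ 2) H j).
Proof.
apply: (@lev_prod _ _ _ (fun i => q ^+ 2 ^+ H - q ^+ 2 ^+ i)) => i _.
by rewrite -!exprM; apply: levB; apply: lev_q.
Qed.

Lemma lev_Kj j : I 1 (Kj j).
Proof.
rewrite /Kj; apply: levMr; last exact: lev_fallp.
apply: levMr; last exact: lev_flip.
apply: levMr; last by apply/levX/lev_q.
apply: levMr; first exact: lev_poch_qV.
by apply: lev_poch; apply: lev_q.
Qed.

(** The factor of index H - 2 is 1 - q^(2H-1) = 1 - q^m, and it is present because j < 2. *)
Lemma poch_q3_low j : (j < 2)%N -> exists2 v, I 0 v & P (q ^+ 3) (H - j) = v * (1 - u).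
Proof.
move=> hj; have hH := half_mE; have h2 := H_ge2.
have -> : (H - j = (H - 2).+1 + (1 - j))%N by lia.
exists (P (q ^+ 3) (H - 2) * P (q ^+ 3 * q ^+ 2 ^+ (H - 2).+1) (1 - j)).
  by apply: levMl; apply: lev_poch; rewrite -?exprM -?exprD; apply: lev_q.
rewrite pochD pochS mulrAC; congr (_ * _ * (1 - _)).
by rewrite -exprM -exprD; congr (_ ^+ _); lia.
Qed.

Lemma lev_Kj_low j : (j < 2)%N -> I 2 (Kj j).
Proof.
move=> /poch_q3_low [v hv E]; rewrite /Kj E.
apply: levMr; last exact: lev_fallp.
apply: levMr; last exact: lev_flip.
apply: levMr; last by apply/levX/lev_q.
apply: (@levM _ _ 1 1); first exact: lev_poch_qV.
by apply: levMl => //; apply: cg_sym.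
Qed.

(** The factor of index H - 2 in (q^3/u;q^2)_(H-j) is 1 - q^m/u = 0. *)
Lemma Uc_low_A j : (j < 2)%N -> Uc u 1 j = 0.
Proof.
move=> hj; have hH := half_mE; have h2 := H_ge2; have u0 := u_neq0.
rewrite /Uc; have -> : P (q ^+ 3 / (u * 1)) (H - j) = 0; last by rewrite !(mulr0, mul0r).
have -> : (H - j = (H - 2).+1 + (1 - j))%N by lia.
rewrite pochD pochS; have -> : q ^+ 3 / (u * 1) * q ^+ 2 ^+ (H - 2) = 1; last first.
  by rewrite subrr mulr0 mul0r.
rewrite mulr1 mulrAC; apply: (canLR (mulfK u0)); rewrite mul1r.
by rewrite -exprM -exprD; congr (_ ^+ _); lia.
Qed.

Definition Qf w j := \prod_(i < j) Xw w (x i) / \prod_(i < H) Xw w (y i).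

Lemma Uc11 j : Uc 1 1 j = Kj j * Qf 0 j.
Proof.
have := Uc_inv j (oner_neq0 F).
by rewrite invr1 subrr expr0n /= mul0r.
Qed.

Lemma Ucuu j : Uc u u^-1 j = Kj j * Qf w0 j.
Proof. exact: Uc_inv u_neq0. Qed.

Lemma H_lt : (H < m)%N. Proof. by have := half_mE; lia. Qed.

Lemma lunit_prod_Xw w : I 2 w -> lunit I (\prod_(i < H) Xw w (y i)).
Proof.
move=> hw; apply: (@lunit_prod _ _ _ (fun i => Xw w (y i))) => i hi.
by apply: lunit_Xw => //; have := H_lt; lia.
Qed.

Lemma cg_Qf j : cg I 2 (Qf w0 j) (Qf 0 j).
Proof.
have h0 : I 2 (0 : F) by apply: lev0.
apply: cg_div.
- by apply: (@lev_prod _ _ _ (fun i => Xw 0 (x i))) => i _; apply/lev_Xw/lev_x.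
- exact/lunit_prod_Xw/lev_w0.
- exact: lunit_prod_Xw.
- apply: (@cg_prod _ _ _ _ (fun i => Xw w0 (x i)) (fun i => Xw 0 (x i))) => i _.
    by apply/lev_Xw/lev_x.
  by apply: cg_Xw; [apply: lev_w0|apply: lev_x].
- apply: (@cg_prod _ _ _ _ (fun i => Xw w0 (y i)) (fun i => Xw 0 (y i))) => i _.
    by apply/lev_Xw/lev_y.
  by apply: cg_Xw; [apply: lev_w0|apply: lev_y].
Qed.

Lemma Uc_low j : (j < 2)%N -> I 4 (Uc 1 1 j - Uc u u^-1 j).
Proof.
move=> hj; rewrite Uc11 Ucuu -mulrBr; apply: (@levM _ _ 2 2); first exact: lev_Kj_low.
by apply: cg_sym; apply: cg_Qf.
Qed.

(** * First-order expansion in w and the logarithmic derivative *)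

Lemma Xw_expand w k (z : nat -> F) : I 2 w ->
    (forall i, (i < k)%N -> I 0 (z i)) -> (forall i, (i < k)%N -> lunit I (1 - z i)) ->
  cg I 4 (\prod_(i < k) Xw w (z i))
    (\prod_(i < k) Xw 0 (z i) * (1 - w * \sum_(i < k) z i / (1 - z i) ^+ 2)).
Proof.
move=> hw; elim: k => [|k IH] hz hu.
  by rewrite !big_ord0 mulr0 subr0 mul1r; apply: cg_refl.
have {}IH : cg I 4 (\prod_(i < k) Xw w (z i))
    (\prod_(i < k) Xw 0 (z i) * (1 - w * \sum_(i < k) z i / (1 - z i) ^+ 2)).
  by apply: IH => i hi; [apply: hz|apply: hu]; apply: ltnW.
have hS : I 0 (\sum_(i < k) z i / (1 - z i) ^+ 2).
  apply: (@lev_sum _ _ _ _ (fun i => z i / (1 - z i) ^+ 2)) => i hi.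
  by apply: lev_div; [apply: hz|apply/lunitX/hu]; apply: ltnW.
have h0 : I 2 (0 : F) by apply: lev0.
have hP : I 0 (\prod_(i < k) Xw 0 (z i)).
  by apply: (@lev_prod _ _ _ (fun i => Xw 0 (z i))) => i hi; apply: lev_Xw => //; apply/hz/ltnW.
have uk := hu k (ltnSn k); have Ok := hz k (ltnSn k); have n0 := lunit_neq0 uk.
have hs : I 0 (z k / (1 - z k) ^+ 2) by apply: lev_div => //; apply: lunitX.
rewrite !big_ord_recr /=.
have -> : Xw w (z k) = Xw 0 (z k) * (1 - w * (z k / (1 - z k) ^+ 2)).
  by rewrite /Xw; field; rewrite n0.
move: IH hS hP hs (lev_Xw h0 Ok); set A := \prod_(i < k) _; set B := \prod_(i < k) _.
set S := \sum_(i < k) _; set t := _ / _; set X := Xw _ _; move: A B S t X => A B S t X.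
move=> IH hS hB ht hX; have Ow := lev_w hw; rewrite /cg.
(* The new error term is quadratic in w, hence of order four. *)
have -> : A * (X * (1 - w * t)) - B * X * (1 - w * (S + t)) =
   (A - B * (1 - w * S)) * (X * (1 - w * t)) + B * X * S * t * (w * w) by ring.
have O1 := lev1 I; apply: levD; first by apply: levMr => //; lv.
by apply: levMl; [lv|apply: (@levM _ _ 2 2)].
Qed.

(* Since k (m - k) has cyclic second difference -2 away from k = 0, its discrete
   Fourier transform inverts (1 - z)^2 / z at the m-th roots of unity z <> 1. *)
Lemma quad_geom_sum (z : F) L :
  (1 - z) ^+ 3 * \sum_(k < L) k%:R * (m%:R - k%:R) * z ^+ k =
  m%:R * (1 - z) * (z - L%:R * z ^+ L + (L%:R - 1) * z ^+ L.+1)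
  - (z + z ^+ 2 - L%:R ^+ 2 * z ^+ L + (2%:R * L%:R ^+ 2 - 2%:R * L%:R - 1) * z ^+ L.+1
     - (L%:R - 1) ^+ 2 * z ^+ L.+2).
Proof.
elim: L => [|L IH]; first by rewrite big_ord0 expr0; ring.
by rewrite big_ord_recr /= mulrDr IH -(natr1 L) !exprS; ring.
Qed.

Lemma sum_quad L :
  6%:R * \sum_(k < L) k%:R * (m%:R - k%:R) =
  (3%:R * m%:R * L%:R * (L%:R - 1) - L%:R * (L%:R - 1) * (2%:R * L%:R - 1)) :> F.
Proof.
elim: L => [|L IH]; first by rewrite big_ord0; ring.
by rewrite big_ord_recr /= mulrDr IH -(natr1 L); ring.
Qed.

Lemma natr_unit k : (0 < k)%N -> lunit I k%:R.
Proof. by case: k. Qed.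

Lemma quad_inverse z : I 0 z -> lunit I (1 - z) -> cg I 1 (z ^+ m) 1 ->
  cg I 1 (z / (1 - z) ^+ 2)
    ((2%:R * m%:R)^-1 * \sum_(k < m) k%:R * (m%:R - k%:R) * z ^+ k).
Proof.
move=> hz hu hm; have n1 := lunit_neq0 hu.
have u2 := natr_unit (isT : (0 < 2)%N); have um : lunit I m%:R by apply: natr_unit; lia.
have n2 := lunit_neq0 u2; have n3 := lunit_neq0 um.
have E := quad_geom_sum z m.
have -> : \sum_(k < m) k%:R * (m%:R - k%:R) * z ^+ k =
  (m%:R * (1 - z) * (z - m%:R * z ^+ m + (m%:R - 1) * z ^+ m.+1)
  - (z + z ^+ 2 - m%:R ^+ 2 * z ^+ m + (2%:R * m%:R ^+ 2 - 2%:R * m%:R - 1) * z ^+ m.+1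
     - (m%:R - 1) ^+ 2 * z ^+ m.+2)) / (1 - z) ^+ 3.
  by rewrite -E mulrC mulKf // expf_neq0.
rewrite /cg (exprS z m.+1) (exprS z m).
have -> : z / (1 - z) ^+ 2 - (2%:R * m%:R)^-1 * ((m%:R * (1 - z) *
   (z - m%:R * z ^+ m + (m%:R - 1) * (z * z ^+ m)) -
   (z + z ^+ 2 - m%:R ^+ 2 * z ^+ m +
    (2%:R * m%:R ^+ 2 - 2%:R * m%:R - 1) * (z * z ^+ m) -
    (m%:R - 1) ^+ 2 * (z * (z * z ^+ m)))) / (1 - z) ^+ 3) =
 (z ^+ m - 1) * (- (m%:R * (1 - z) * (- m%:R + (m%:R - 1) * z) + m%:R ^+ 2
   - (2%:R * m%:R ^+ 2 - 2%:R * m%:R - 1) * z + (m%:R - 1) ^+ 2 * z ^+ 2)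
   / (2%:R * m%:R * (1 - z) ^+ 3)).
  by field; rewrite n1 n2 n3.
apply: levMr => //; apply: lev_div.
  have Om := lunit_lev um; have O2 := lunit_lev u2; have O1 := lev1 I.
  by lv.
by apply: lunitM; [apply: lunitM|apply: lunitX].
Qed.

(** As m is odd, the y_j = q^(2j+2) run modulo Phi_m through all m-th roots of unity except 1, whose
    k-th powers add up to -1. *)
Lemma geom_sum k : (0 < k < m)%N -> cg I 1 (\sum_(j < m.-1) y j ^+ k) (-1).
Proof.
move=> /andP [k0 km]; pose z := q ^+ (2 * k).
have hu : lunit I (1 - z).
  apply: q_sub1; rewrite Gauss_dvdr ?coprimen2 //.
  by apply/negP => /dvdn_leq -/(_ k0); lia.
have E : \sum_(j < m.-1) y j ^+ k + 1 = \sum_(j < m) z ^+ j.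
  rewrite -[in RHS](prednK (ltnW m_gt1)) big_ord_recl expr0 addrC; congr (_ + _).
  by apply: eq_bigr => j _; rewrite /evenq /z lift0 -!exprM; congr (_ ^+ _); nia.
rewrite /cg opprK E.
have -> : \sum_(j < m) z ^+ j = - (z ^+ m - 1) / (1 - z).
  by rewrite subrX1; field; rewrite (lunit_neq0 hu).
apply: lev_div => //; apply: levN.
have -> : z ^+ m = q ^+ (m * (2 * k)) by rewrite /z -exprM mulnC.
exact: cg_qm.
Qed.

Lemma cg_sum_y_full :
  cg I 1 (\sum_(j < m.-1) y j / (1 - y j) ^+ 2) ((1 - m%:R ^+ 2) / 12%:R).
Proof.
have u2 := natr_unit (isT : (0 < 2)%N); have um : lunit I m%:R by apply: natr_unit; lia.
have u12 := natr_unit (isT : (0 < 12)%N); have u6 := natr_unit (isT : (0 < 6)%N).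
have n2 := lunit_neq0 u2; have n3 := lunit_neq0 um.
apply: (@cg_trans _ _ _ (\sum_(j < m.-1) (2%:R * m%:R)^-1 *
    \sum_(k < m) k%:R * (m%:R - k%:R) * y j ^+ k)).
  apply: (@cg_sum _ _ _ _ (fun j => y j / (1 - y j) ^+ 2) (fun j =>
    (2%:R * m%:R)^-1 * \sum_(k < m) k%:R * (m%:R - k%:R) * y j ^+ k)) => j hj.
  apply: quad_inverse; [exact: lev_y|by apply: lunit_oney; lia|].
  by rewrite /evenq -exprM mulnC; apply: cg_qm.
rewrite -mulr_sumr exchange_big /=.
have -> : (1 - m%:R ^+ 2) / 12%:R = (2%:R * m%:R)^-1 *
   \sum_(k < m) k%:R * (m%:R - k%:R) * (-1) :> F.
  rewrite -mulr_suml; have := sum_quad m; set S := \sum_(k < m) _ => ES.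
  have -> : S = (3%:R * m%:R * m%:R * (m%:R - 1)
      - m%:R * (m%:R - 1) * (2%:R * m%:R - 1)) / 6%:R.
    by rewrite -ES mulrC mulKf // (lunit_neq0 u6).
  by field; rewrite n2 n3 (lunit_neq0 u12) (lunit_neq0 u6).
apply: cgM.
- by case: (lunitM u2 um).
- apply: (@lev_sum _ _ _ _ (fun k => k%:R * (m%:R - k%:R) * (-1))) => k _.
  by have O1 := lev1 I; lv.
- exact: cg_refl.
apply: (@cg_sum _ _ _ _ (fun k => \sum_(j < m.-1) k%:R * (m%:R - k%:R) * y j ^+ k)
  (fun k => k%:R * (m%:R - k%:R) * (-1))) => k hk.
rewrite -mulr_sumr; case: (posnP k) => [->|k0].
  by rewrite !mul0r; apply: cg_refl.
by have O1 := lev1 I; apply: cgM; [lv|lv|apply: cg_refl|apply: geom_sum; rewrite k0].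
Qed.

(** The reflection from j to m - 2 - j inverts y_j modulo Phi_m, and y/(1-y)^2 is invariant under
    inversion; half of the range thus carries half of the full sum. *)
Lemma cg_sum_y :
  cg I 1 (\sum_(j < H.-1) y j / (1 - y j) ^+ 2) ((1 - m%:R ^+ 2) / 24%:R).
Proof.
have hH := half_mE; have u2 := natr_unit (isT : (0 < 2)%N).
pose g j := y j / (1 - y j) ^+ 2.
have E : cg I 1 (\sum_(j < H.-1) g (H.-1 + j)%N) (\sum_(j < H.-1) g j).
  rewrite (reindex_inj rev_ord_inj) /=.
  apply: (@cg_sum _ _ _ _ (fun j => g (H.-1 + (H.-1 - j.+1))%N) g) => j hj.
  set j' := (H.-1 + _)%N.
  have v1 : lunit I (1 - y j) by apply: lunit_oney; lia.
  have v2 : lunit I (1 - y j') by apply: lunit_oney; rewrite /j'; lia.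
  have hxy : cg I 1 (y j' * y j) 1.
    rewrite /evenq -exprD; have -> : (2 * j' + 2 + (2 * j + 2) = m * 2)%N by rewrite /j'; lia.
    exact: cg_qm.
  rewrite /cg /g.
  have -> : y j' / (1 - y j') ^+ 2 - y j / (1 - y j) ^+ 2 =
    (y j' * y j - 1) * ((y j - y j') / ((1 - y j') ^+ 2 * (1 - y j) ^+ 2)).
    by field; rewrite (lunit_neq0 v1) (lunit_neq0 v2).
  apply: levMr => //; apply: lev_div; first by apply: levB; apply: lev_y.
  by apply: lunitM; apply: lunitX.
have := cg_sum_y_full.
have -> : m.-1 = (H.-1 + H.-1)%N by lia.
rewrite (sum_ordD g) => E2.
have n2 := lunit_neq0 u2; have u12 := natr_unit (isT : (0 < 12)%N).
have -> : (1 - m%:R ^+ 2) / 24%:R = (1 - m%:R ^+ 2) / 12%:R / 2%:R :> F.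
  by field; rewrite n2 (lunit_neq0 u12) (lunit_neq0 (nat_unit 23)).
have E3 := cg_trans (cg_sym (cgD (cg_refl I 1 (\sum_(j < H.-1) g j)) E)) E2.
rewrite -/g; set S := \sum_(j < H.-1) _ in E3 *.
have -> : S = (S + S) / 2%:R by field.
apply: cgM => //; [|by case: u2|exact: cg_refl].
apply: lev_div => //; have O1 := lev1 I; have Om := lev_nat I m; lv.
Qed.

(** * The coefficient at j = 2 and the constant Omega *)

Lemma lunit_1q : lunit I (1 - q).
Proof. by rewrite -[X in 1 - X]expr1; apply: q_sub1; rewrite dvdn1; lia. Qed.

Lemma lunit_uq : lunit I (u - q).
Proof. by apply: (lunit_cg lunit_1q); apply: cgB => //; apply: cg_refl. Qed.

Lemma lunit_1uq : lunit I (1 - u * q).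
Proof.
rewrite -exprSr; apply: q_sub1; rewrite -addn1 dvdn_addr ?dvdnn // dvdn1; lia.
Qed.

Lemma lev_1u : I 1 (1 - u). Proof. exact: cg_sym. Qed.

Lemma lunit_poch a : cg I 1 a (q ^+ 2) -> lunit I (P a H).
Proof.
move=> ha; apply: (@lunit_cg _ _ (P (q ^+ 2) H)).
  rewrite -even_poch; apply: (@lunit_prod _ _ _ (fun i => 1 - y i)) => i hi.
  by apply: lunit_oney; have := H_lt; lia.
by apply: cg_poch => //; apply: lev_q.
Qed.

Lemma cg_uV : cg I 1 u^-1 1.
Proof. by rewrite -[X in cg I 1 _ X]invr1; apply: cgV => //; [apply: lunit_u|apply: lunit1]. Qed.

(** Both coefficients contain 1 - u, the last factor of (1/q;q^2)_(H+1), so it is enough that the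
    cofactors agree modulo Phi_m. *)
Lemma cg_UcA_w : cg I 2 (Uc u 1 2) (Uc u u^-1 2).
Proof.
have q0 := q_neq0; have u0 := u_neq0; have O1 := lev1 I; have hu := lunit_u.
have hV := cg_uV; have Oq k := lev_q k; have [_ _ OqV] := q_unit; have [_ _ OuV] := hu.
pose W a1 a2 b1 b2 g := P q^-1 H * a1 * a2 / (b1 * b2) * P g (H - 2) * g ^+ 2
  * \prod_(i < 2) (- (q ^+ 2 ^+ i / q ^+ 2 ^+ 2)) * fallp (q ^+ 2) H 2.
have E dl ep : Uc dl ep 2 = (1 - u) * W (P (dl / q) 2) (P (ep / q) 2) (P (q ^+ 2 / dl) H)
    (P (q ^+ 2 / ep) H) (q ^+ 3 / (dl * ep)).
  have E1 : P q^-1 H.+1 = P q^-1 H * (1 - u).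
    by rewrite pochS p_H; congr (_ * (1 - _)); field.
  by rewrite /Uc /W E1; ring.
rewrite !E /cg -mulrBr; apply: (@levM _ _ 1 1); first exact: lev_1u.
have h1 : cg I 1 (1 / q) (u^-1 / q).
  by apply: cgM => //; [apply: cg_sym|apply: cg_refl].
have g1 : cg I 1 (q ^+ 2 / 1) (q ^+ 2 / u^-1).
  apply: cgM; [exact: Oq|by rewrite invrK; apply: Oq|exact: cg_refl|].
  by rewrite invr1 invrK; apply: cg_sym.
have g2 : cg I 1 (q ^+ 3 / (u * 1)) (q ^+ 3 / (u * u^-1)).
  by rewrite mulr1 divff // divr1 -[X in cg I 1 _ X]mulr1; apply: cgM => //; apply: cg_refl.
have v1 : lunit I (P (q ^+ 2 / u) H).
  by apply: lunit_poch; rewrite -[X in cg I 1 _ X]mulr1; apply: cgM => //; apply: cg_refl.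
have v2 : lunit I (P (q ^+ 2 / u^-1) H).
  by apply: lunit_poch; rewrite invrK -[X in cg I 1 _ X]mulr1; apply: cgM => //; apply: cg_refl.
have v3 : lunit I (P (q ^+ 2 / 1) H) by apply: lunit_poch; rewrite divr1; apply: cg_refl.
have O2 : I 0 (u^-1 / q) by apply: levMl.
have O3 : I 0 (q ^+ 3 / (u * u^-1)) by rewrite divff // divr1; apply: Oq.
have P1 := lev_poch H OqV; have P2 : I 0 (P (u / q) 2) by apply: lev_poch; apply: levMl.
have P3 := lev_poch 2 O2; have P4 := lev_poch (H - 2) O3.
have c1 := cg_poch 2 O2 h1; have c2 := cg_poch (H - 2) O3 g2.
have Og : I 0 (q ^+ 2 / u^-1) by rewrite invrK; apply: levMl.
have c3 := cg_poch H Og g1.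
have F1 := lev_flip 2; have F2 := lev_fallp 2.
have v12 := lunitM v1 v2; have v13 := lunitM v1 v3.
have c4 : cg I 1 (P (q ^+ 2 / u) H * P (q ^+ 2 / 1) H)^-1
    (P (q ^+ 2 / u) H * P (q ^+ 2 / u^-1) H)^-1.
  by apply: cgV => //; apply: cgM => //; [exact: lunit_lev|exact: lunit_lev|exact: cg_refl].
have [_ _ O4] := v12.
rewrite -/(cg I 1 _ _) /W.
by cgt.
Qed.

Definition nu : F := (m%:R ^+ 2 - 1) / 24%:R.

(* Omega_q(n), rescaled by (1-q)^5 (1+q^2) / q^4. *)
Definition Om : F := (1 - u) * q ^+ (H - 2) * (1 - q) ^+ 2 *
  ((1 - u) ^+ 2 * (nu * (1 - q) ^+ 2 - q) - (1 - q) ^+ 4 / (q * ((1 - u * q) * (1 - u / q)))).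

Lemma cg_Qf2 : cg I 4 (Qf w0 2) (Qf 0 2 * (1 - w0 *
  (\sum_(i < 2) x i / (1 - x i) ^+ 2 - \sum_(i < H) y i / (1 - y i) ^+ 2))).
Proof.
have hw := lev_w0; have Ow := lev_w hw; have h0 : I 2 (0 : F) by apply: lev0.
have q0 := q_neq0; have O1 := lev1 I; have u1 := lunit_1q; have hH := H_lt.
have ux i : (i < 2)%N -> lunit I (1 - x i).
  case: i => [|[|]] // _; last by have -> : x 1 = q by rewrite /oddq; field.
  have -> : 1 - x 0 = - ((1 - q) / q) by rewrite /oddq muln0 expr0; field.
  by apply/lunitN/lunitM => //; apply: lunitV.
have uy i : (i < H)%N -> lunit I (1 - y i) by move=> hi; apply: lunit_oney; lia.
have eA := Xw_expand hw (fun i _ => lev_x i) ux.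
have eD := Xw_expand hw (fun i _ => lev_y i) uy.
have vw := lunit_prod_Xw hw; have v0 := lunit_prod_Xw h0.
have OA : I 0 (\prod_(i < 2) Xw 0 (x i)).
  by apply: (@lev_prod _ _ _ (fun i => Xw 0 (x i))) => i _; apply/lev_Xw/lev_x.
have OS : I 0 (\sum_(i < 2) x i / (1 - x i) ^+ 2).
  apply: (@lev_sum _ _ _ _ (fun i => x i / (1 - x i) ^+ 2)) => i hi.
  by apply: lev_div; [apply: lev_x|apply/lunitX/ux].
have OT : I 0 (\sum_(i < H) y i / (1 - y i) ^+ 2).
  apply: (@lev_sum _ _ _ _ (fun i => y i / (1 - y i) ^+ 2)) => i hi.
  by apply: lev_div; [apply: lev_y|apply/lunitX/uy].
move: eA eD vw v0 OA OS OT; rewrite /Qf.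
set A := \prod_(i < 2) _; set A0 := \prod_(i < 2) _; set S := \sum_(i < 2) _.
set D := \prod_(i < H) _; set D0 := \prod_(i < H) _; set T := \sum_(i < H) _.
move: A A0 S D D0 T => A A0 S D D0 T eA eD vw v0 OA OS OT; rewrite /cg.
have nw := lunit_neq0 vw; have n0 := lunit_neq0 v0; have OD0 := lunit_lev v0.
have -> : A / D - A0 / D0 * (1 - w0 * (S - T)) =
   ((A - A0 * (1 - w0 * S)) - A0 / D0 * (1 - w0 * (S - T)) * (D - D0 * (1 - w0 * T))
    + A0 * T * (S - T) * - (w0 * w0)) / D.
  by field; rewrite nw n0.
apply: lev_div => //; have OAD : I 0 (A0 / D0) by apply: lev_div.
apply: levD; first apply: levB => //.
  by apply: levMl; [lv|].
by apply: levMl; [lv|apply: levN; apply: (@levM _ _ 2 2)].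
Qed.

(** The terms at x_0 = 1/q and x_1 = q are both q/(1-q)^2. One of them is cancelled by the last term
    of the second sum, at y_(H-1) = uq; the remaining half-range sum gives [nu]. *)
Lemma cg_logder : cg I 1
  (\sum_(i < 2) x i / (1 - x i) ^+ 2 - \sum_(i < H) y i / (1 - y i) ^+ 2)
  (q / (1 - q) ^+ 2 + nu).
Proof.
have q0 := q_neq0; have u1 := lunit_1q; have n1 := lunit_neq0 u1; have hH := half_mE.
have -> : \sum_(i < 2) x i / (1 - x i) ^+ 2 = 2%:R * q / (1 - q) ^+ 2.
  rewrite !big_ord_recl big_ord0 /= /bump /= /oddq muln0 muln1 expr0.
  by field; rewrite q0 n1 /= -oppr_eq0 opprB.
have H0 : (0 < H)%N by have := H_ge2; lia.
rewrite -[in \sum_(i < H) _](prednK H0) big_ord_recr /=.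
have -> : y H.-1 = u * q by rewrite /evenq -exprSr; congr (_ ^+ _); lia.
have v1 := lunit_1uq; have O1 := lev1 I; have Oq := lev_q 1; rewrite expr1 in Oq.
have Ou := lev_u.
have c1 : cg I 1 (u * q / (1 - u * q) ^+ 2) (q / (1 - q) ^+ 2).
  have c0 : cg I 1 (u * q) q.
    by rewrite -[X in cg I 1 _ X]mul1r; apply: cgM => //; apply: cg_refl.
  apply: cg_div => //; try exact: lunitX.
  by apply: cgX; [lv|apply: cgB => //; apply: cg_refl].
have -> : q / (1 - q) ^+ 2 + nu =
    2%:R * q / (1 - q) ^+ 2 - ((1 - m%:R ^+ 2) / 24%:R + q / (1 - q) ^+ 2).
  by rewrite /nu; field; rewrite n1 (lunit_neq0 (nat_unit 23)).
apply: cgB; first exact: cg_refl.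
by apply: cgD => //; apply: cg_sum_y.
Qed.

Lemma lev_UcA2 : I 1 (Uc u 1 2).
Proof.
rewrite UcA2; have O1 := lev1 I; have [_ _ OqV] := q_unit; have [_ _ OuV] := lunit_u.
have Ou := lev_u; have Oq := lunit_lev q_unit.
rewrite -!mulrA -exprVn; apply: levMr; first exact: lev_1u.
by lv.
Qed.

(** The product of [Uc u 1 2] and [w0] has order 3, so the logarithmic derivative may be replaced
    modulo Phi_m. As [w0] has order 2, [Uc 1 1 2] may be replaced by [Uc u 1 2], which agrees with
    it to order 2. *)
Lemma Uc_diff : cg I 4 (Uc 1 1 2 - Uc u u^-1 2) (Uc u 1 2 * w0 * (q / (1 - q) ^+ 2 + nu)).
Proof.
have hw := lev_w0; have Ow := lev_w hw; have hl := cg_logder; have h2 := cg_Qf2.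
set L := _ - _ in hl h2; set Lc := _ + _ in hl *.
have u1 := lunit_1q; have OLc : I 0 Lc.
  have Oq := lunit_lev q_unit; have O1 := lev1 I; have Om := lev_nat I m.
  apply: levD; first by apply: lev_div => //; apply: lunitX.
  by apply: lev_div; [lv|apply: nat_unit].
have OL := cg_lev hl OLc.
have e1 : cg I 2 (Uc 1 1 2) (Uc u 1 2).
  apply: cg_trans (cg_sym cg_UcA_w); rewrite Uc11 Ucuu /cg -mulrBr.
  by apply: levMl; [apply: lev_w (lev_Kj 2)|apply: cg_sym; apply: cg_Qf].
have -> : Uc 1 1 2 - Uc u u^-1 2 = Kj 2 * (Qf 0 2 - Qf w0 2).
  by rewrite Uc11 Ucuu mulrBr.
rewrite /cg.
have -> : Kj 2 * (Qf 0 2 - Qf w0 2) - Uc u 1 2 * w0 * Lc =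
   - (Kj 2 * (Qf w0 2 - Qf 0 2 * (1 - w0 * L)))
   + w0 * (Uc 1 1 2 - Uc u 1 2) * L + Uc u 1 2 * w0 * (L - Lc).
  by rewrite Uc11; ring.
apply: levD; first apply: levD.
- by apply/levN/levMl => //; apply: lev_w (lev_Kj 2).
- by apply: levMr => //; apply: (@levM _ _ 2 2).
- by apply: (@levM _ _ 3 1) => //; apply: (@levM _ _ 1 2) => //; apply: lev_UcA2.
Qed.

Lemma Uc2_main : I 4 (Uc u 1 2 + Uc 1 1 2 - Uc u u^-1 2 - Om).
Proof.
have hd := Uc_diff; have q0 := q_neq0; have u0 := u_neq0; have u1 := lunit_1q.
have v1 := lunit_1uq; have v2 := lunit_uq; have hw := lev_w0; have Ow := lev_w hw.
set Lc := _ + nu in hd.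
have -> : Uc u 1 2 + Uc 1 1 2 - Uc u u^-1 2 - Om =
   (Uc 1 1 2 - Uc u u^-1 2 - Uc u 1 2 * w0 * Lc)
   + (Uc u 1 2 * (1 + w0 * Lc) - Om) by ring.
apply: levD => //.
(* The first factor has order 3. The second vanishes at u = 1 and gives the fourth order. *)
have -> : Uc u 1 2 * (1 + w0 * Lc) - Om =
  ((1 - u) * w0) * ((1 - u) * ((1 + u) * (nu * (1 - q) ^+ 2 - q))
    - w0 * (q * Lc + q ^+ 2 * u / ((1 - u * q) * (u - q))))
  * (q ^+ (H - 2) * (1 - q) ^+ 2 / u).
  rewrite UcA2 /Om /Lc /w0; move: nu => nu'.
  move: u0 (lunit_neq0 u1) (lunit_neq0 v1) (lunit_neq0 v2).
  move: (u) (q ^+ (H - 2)) => U Q U0 n1 n2 n3.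
  have n4 : q - U != 0 by rewrite -oppr_eq0 opprB.
  by field; rewrite U0 q0 n1 n2 n3 n4.
have Oq := lunit_lev q_unit; have O1 := lev1 I; have Om := lev_nat I m; have Ou := lev_u.
have Onu : I 0 nu by apply: lev_div; [lv|apply: nat_unit].
have OLc : I 0 Lc by apply: levD => //; apply: lev_div => //; apply: lunitX.
apply: levMr; last first.
  by apply: lev_div; [lv|apply: lunit_u].
apply: (@levM _ _ 3 1); first by apply: (@levM _ _ 1 2) => //; apply: lev_1u.
apply: levB; first by apply: levMr; [apply: lev_1u|lv].
apply: levMr; first by apply: lev_leq hw.
apply: levD; first by lv.
by apply: lev_div; [lv|apply: lunitM].
Qed.

Lemma poch_q3 k : P (q ^+ 3) k = \prod_(i < k) (1 - x (2 + i)).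
Proof.
by apply: eq_bigr => i _; rewrite x2E -exprM -exprD addnC.
Qed.

Lemma Uc_main k : (k.+2 <= H)%N ->
  I 4 (Uc u 1 k.+2 + Uc 1 1 k.+2 - Uc u u^-1 k.+2
       - Om * (P (q ^+ 3) k ^+ 3 / P (q ^+ 2) k)).
Proof.
move=> hk; have hH := half_mE; have hw := lev_w0; have h0 : I 2 (0 : F) by apply: lev0.
pose A w := \prod_(i < k) Xw w (x (2 + i)).
pose tau := \prod_(i < k) ((1 - x (2 + i)) / (1 - y i)).
pose th := \prod_(i < k) ((u - x (2 + i)) / (u - y i)).
have u1 i : (i < k)%N -> lunit I (1 - y i) by move=> hi; apply: lunit_oney; lia.
have u2 i : (i < k)%N -> lunit I (u - y i).
  by move=> hi; apply: lunit_by => //; lia.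
have EA : Uc u 1 k.+2 = Uc u 1 2 * (A w0 * tau).
  rewrite UcA_closed // -big_split; congr (_ * _); apply: eq_bigr => i _.
  by rewrite /UcA_ratio /= mulrA.
have Ew : Uc u u^-1 k.+2 = Uc u u^-1 2 * (A w0 * th).
  by rewrite (Ucw_closed u_neq0) // -big_split.
have E0 : Uc 1 1 k.+2 = Uc 1 1 2 * (A 0 * th).
  rewrite -{2 4}(invr1 F) (Ucw_closed (oner_neq0 F)) // subrr expr0n /= mul0r.
  by rewrite -big_split.
have Et : P (q ^+ 3) k ^+ 3 / P (q ^+ 2) k = A 0 * tau.
  rewrite poch_q3 -even_poch /A /tau prodf_div.
  have -> : \prod_(i < k) Xw 0 (x (2 + i)) = (\prod_(i < k) (1 - x (2 + i))) ^+ 2.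
    by rewrite -prodrXl; apply: eq_bigr => i _; rewrite /Xw mulr0 subr0.
  by rewrite exprSr mulrA.
have OA : I 0 (A 0).
  by apply: (@lev_prod _ _ _ (fun i => Xw 0 (x (2 + i)))) => i _; apply/lev_Xw/lev_x.
have cA : cg I 2 (A w0) (A 0).
  apply: (@cg_prod _ _ _ _ (fun i => Xw w0 (x (2 + i))) (fun i => Xw 0 (x (2 + i)))) => i _.
    by apply/lev_Xw/lev_x.
  by apply: cg_Xw => //; apply: lev_x.
have O1 := lev1 I.
have Ot i : (i < k)%N -> I 0 ((1 - x (2 + i)) / (1 - y i)).
  by move=> hi; apply: lev_div; [apply: levB => //; apply: lev_x|apply: u1].
have Otau : I 0 tau by apply: (@lev_prod _ _ _ (fun i => (1 - x (2 + i)) / (1 - y i))).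
have cth : cg I 1 th tau.
  apply: (@cg_prod _ _ _ _ (fun i => (u - x (2 + i)) / (u - y i))
    (fun i => (1 - x (2 + i)) / (1 - y i))) => // i hi.
  apply: cg_div; [by apply: levB => //; apply: lev_x|exact: u2|exact: u1|..].
  - by apply: cgB => //; apply: cg_refl.
  - by apply: cgB => //; apply: cg_refl.
have a1 := Uc2_main; have a2 := cg_UcA_w; have a3 := lev_UcA2.
have a4 : I 3 (Uc 1 1 2 - Uc u u^-1 2).
  rewrite Uc11 Ucuu -mulrBr; apply: (@levM _ _ 1 2); first exact: lev_Kj.
  by apply: cg_sym; apply: cg_Qf.
have a5 : I 1 (Uc u u^-1 2).
  rewrite Ucuu; apply: levMr; first exact: lev_Kj.
  apply: (cg_lev (cg_Qf 2)); apply: lev_div; last exact: lunit_prod_Xw.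
  by apply: (@lev_prod _ _ _ (fun i => Xw 0 (x i))) => i _; apply/lev_Xw/lev_x.
rewrite EA E0 Ew Et.
move: a1 a2 a3 a4 a5 cA OA cth Otau; rewrite /cg.
move: (Uc u 1 2) (Uc 1 1 2) (Uc u u^-1 2) (A w0) (A 0) (th) (tau) Om.
move=> a b0 bw Aw A0 t2 t1 o a1 a2 a3 a4 a5 cA OA cth Ot1.
(* The orders are 4, then 3 + 1, then 2 + 2: [a - bw] has order 2, and [bw * (t2 - t1)] has order 1
   + 1. *)
have -> : a * (Aw * t1) + b0 * (A0 * t2) - bw * (Aw * t2) - o * (A0 * t1) =
  (a + b0 - bw - o) * (A0 * t1) + (b0 - bw) * (t2 - t1) * A0
  + (Aw - A0) * ((a - bw) * t1 - bw * (t2 - t1)) by ring.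
apply: levD; first apply: levD.
- by apply: levMr => //; apply: levMl.
- by apply: levMr => //; apply: (@levM _ _ 3 1).
- apply: (@levM _ _ 2 2) => //; apply: levB; first exact: levMr.
  exact: (@levM _ _ 1 1).
Qed.

(** * From Watson's sums back to the left-hand sum *)

Definition Gj j := P (q ^+ 3 / (c * d)) j * q ^+ 2 ^+ j
  / (P (q ^+ 2) j * P (q ^+ 2 / c) j * P (q ^+ 2 / d) j).

Lemma lev_Gj j : (j <= H)%N -> I 0 (Gj j).
Proof.
move=> hj; have hH := H_lt; have [c0 _ OcV] := c_unit; have [d0 _ OdV] := d_unit.
have Ob b : b \in [:: c; d] -> lunit I (P (q ^+ 2 / b) j).
  move=> hb; have hub : lunit I b by move: hb; rewrite !inE => /orP [] /eqP ->.
  apply: (@lunit_prod _ _ _ (fun i => 1 - q ^+ 2 / b * q ^+ 2 ^+ i)) => i _.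
  have -> : 1 - q ^+ 2 / b * q ^+ 2 ^+ i = (b - q ^+ (2 + 2 * i)) / b.
    by rewrite exprD exprM; field; rewrite (lunit_neq0 hub).
  apply: lunitM; last exact: lunitV.
  by move: hb; rewrite !inE => /orP [] /eqP ->.
apply: lev_div.
  apply: levMl; last by rewrite -exprM; apply: lev_q.
  by apply: lev_poch; apply: lev_div; [apply: lev_q|apply: lunitM].
apply: lunitM; last by apply: Ob; rewrite !inE eqxx orbT.
apply: lunitM; last by apply: Ob; rewrite !inE eqxx.
rewrite -even_poch; apply: (@lunit_prod _ _ _ (fun i => 1 - y i)) => i hi.
by apply: lunit_oney; lia.
Qed.

Lemma hf_ratio b i : b != 0 -> b - y i != 0 ->
  (1 - b / q * q ^+ 2 ^+ i) / (1 - q^-1 * q ^+ 2 / (b / q) * q ^+ 2 ^+ i) = b * hf b i.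
Proof.
move=> b0 n; have q0 := q_neq0; move: n.
rewrite /hf /oddq /evenq addnC exprD exprM => n.
by field; rewrite n q0 b0.
Qed.

Lemma poch_ratio b r : b != 0 -> (forall i, b - y i != 0) ->
  P (b / q) r / P (q^-1 * q ^+ 2 / (b / q)) r = b ^+ r * \prod_(i < r) hf b i.
Proof.
move=> b0 hb; rewrite -prodf_div.
have -> : b ^+ r = \prod_(i < r) b by rewrite prodr_const card_ord.
by rewrite -big_split; apply: eq_bigr => i _; rewrite hf_ratio.
Qed.

(** The pairs (u,1), (1,1), (u,1/u) for (dl, ep) give the summands of S(u,1), S(1,1/u), S(u,1/u);
    the pair deformed by [u^-1] is common to all three. *)
Definition wterm dl ep r := (1 - q ^+ (4 * r) / q) *
  \prod_(i < r) (q ^+ 7 * hf 1 i * hf dl i * hf ep i * hf u^-1 i * hf c i * hf d i).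

Lemma watson_wterm dl ep : dl != 0 -> ep != 0 ->
    (forall i, dl - y i != 0) -> (forall i, ep - y i != 0) ->
  \sum_(r < H.+1) wterm dl ep r = \sum_(j < H.+1) Uc dl ep j * Gj j.
Proof.
move=> dl0 ep0 hdl hep; have q0 := q_neq0; have u0 := u_neq0; have hH := half_mE.
have c0 := lunit_neq0 c_unit; have d0 := lunit_neq0 d_unit.
have hc i : c - y i != 0 := lunit_neq0 (c_sub _).
have hd i : d - y i != 0 := lunit_neq0 (d_sub _).
have h1 i : 1 - y i != 0 by apply: q_neq1; lia.
have hD b i : b != 0 -> (forall i, b - y i != 0) ->
    1 - q^-1 * q ^+ 2 / (b / q) * q ^+ 2 ^+ i != 0.
  move=> b0 hb.
  have -> : 1 - q^-1 * q ^+ 2 / (b / q) * q ^+ 2 ^+ i = (b - y i) / b.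
    by rewrite /evenq addnC exprD exprM; field; rewrite b0 q0.
  by rewrite mulf_neq0 ?invr_eq0.
have hp i : 1 - q ^+ 2 ^+ i.+1 != 0 by rewrite -exprM q_neq1.
have ha i : 1 - q^-1 * q ^+ 2 ^+ i != 0.
  rewrite -exprM mulrC; case: i => [|i].
    have -> : 1 - q ^+ (2 * 0) / q = - ((1 - q ^+ 1) / q) by rewrite muln0 expr0 expr1; field.
    by rewrite oppr_eq0 mulf_neq0 ?invr_eq0 ?q_neq1.
  have -> : q ^+ (2 * i.+1) / q = q ^+ (2 * i + 1).
    by apply: (canLR (mulfK q0)); rewrite -exprSr; congr (_ ^+ _); lia.
  by rewrite q_neq1 // addn1.
have bq b : b != 0 -> b / q != 0 by move=> b0; rewrite mulf_neq0 ?invr_eq0.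
have := @watson F (q ^+ 2) q^-1 (c / q) (d / q) (dl / q) (ep / q) H (expf_neq0 2 q0)
  (bq _ c0) (bq _ d0) (bq _ dl0) (bq _ ep0) hp ha (fun i => hD _ i c0 hc)
  (fun i => hD _ i d0 hd) (fun i => hD _ i dl0 hdl) (fun i => hD _ i ep0 hep).
move=> W; transitivity (\sum_(r < H.+1) rogers_term (q ^+ 2) q^-1 (dl / q) (ep / q) H r *
  (P (c / q) r * P (d / q) r * (q^-1 * q ^+ 2 / (c / q * (d / q))) ^+ r /
   (P (q^-1 * q ^+ 2 / (c / q)) r * P (q^-1 * q ^+ 2 / (d / q)) r))).
  apply: eq_bigr => r _.
  (* Since p^H = uq for p = q^2, the terminating pair of [rogers_term] is the one deformed by
     [u^-1]. *)
  have Ef : fallp (q ^+ 2) H r / P (q^-1 * q ^+ 2 ^+ H.+1) r =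
      q ^+ r * \prod_(i < r) hf u^-1 i.
    have -> : q ^+ r = \prod_(i < r) q by rewrite prodr_const card_ord.
    rewrite -prodf_div -big_split; apply: eq_bigr => i _ /=.
    have nn : 1 - u * y i != 0 by rewrite -exprD q_neq1 //; lia.
    move: nn; rewrite (exprSr (q ^+ 2)) p_H /hf /oddq /evenq addnC exprD exprM => nn.
    by field; rewrite mulNr [_ * u]mulrC nn q0 u0.
  have E1 : P q^-1 r / P (q ^+ 2) r = \prod_(i < r) hf 1 i.
    rewrite -odd_poch -even_poch -prodf_div.
    by apply: eq_bigr => i _; rewrite /hf mul1r.
  have Edl := poch_ratio r dl0 hdl; have Eep := poch_ratio r ep0 hep.
  have Ec := poch_ratio r c0 hc; have Ed := poch_ratio r d0 hd.
  have E4 : 1 - q^-1 * q ^+ 2 ^+ r ^+ 2 = 1 - q ^+ (4 * r) / q.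
    by rewrite mulrC -!exprM; congr (1 - _ ^+ _ / _); lia.
  rewrite /rogers_term E4.
  set a1 := P q^-1 r in E1 *; set a2 := P (q ^+ 2) r in E1 *.
  set a3 := P (dl / q) r in Edl *; set a4 := P (q^-1 * _ / (dl / q)) r in Edl *.
  set a5 := P (ep / q) r in Eep *; set a6 := P (q^-1 * _ / (ep / q)) r in Eep *.
  set a7 := P (c / q) r in Ec *; set a8 := P (q^-1 * _ / (c / q)) r in Ec *.
  set a9 := P (d / q) r in Ed *; set a10 := P (q^-1 * _ / (d / q)) r in Ed *.
  set a11 := fallp _ _ _ in Ef *; set a12 := P _ r in Ef *.
  set g1 := (_ / (dl / q * _)) ^+ r; set g2 := (_ / (c / q * _)) ^+ r.
  have -> : (1 - q ^+ (4 * r) / q) * a1 * a3 * a5 / (a2 * a4 * a6) * a11 / a12 * g1 *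
     (a7 * a9 * g2 / (a8 * a10)) = (1 - q ^+ (4 * r) / q) * ((a1 / a2) * (a3 / a4) * (a5 / a6)
       * (a11 / a12) * (a7 / a8) * (a9 / a10) * (g1 * g2)).
    by rewrite !invfM; ring.
  have Ew : \prod_(i < r) (q ^+ 7 * hf 1 i * hf dl i * hf ep i * hf u^-1 i * hf c i * hf d i)
     = q ^+ 7 ^+ r * \prod_(i < r) hf 1 i * \prod_(i < r) hf dl i * \prod_(i < r) hf ep i
       * \prod_(i < r) hf u^-1 i * \prod_(i < r) hf c i * \prod_(i < r) hf d i.
    have -> : q ^+ 7 ^+ r = \prod_(i < r) q ^+ 7 by rewrite prodr_const card_ord.
    by rewrite -!big_split.
  rewrite E1 Edl Eep Ef Ec Ed /wterm Ew.
  have -> : g1 * g2 = q ^+ 7 ^+ r / (q ^+ r * dl ^+ r * ep ^+ r * c ^+ r * d ^+ r).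
    rewrite /g1 /g2 -!exprMn -expr_div_n; congr (_ ^+ _).
    by field; rewrite dl0 ep0 c0 d0 q0.
  move: (expf_neq0 r q0) (expf_neq0 r dl0) (expf_neq0 r ep0) (expf_neq0 r c0)
    (expf_neq0 r d0) => m1 m2 m3 m4 m5.
  by field; rewrite m1 m2 m3 m4 m5.
rewrite W; apply: eq_bigr => j _; rewrite /watson_coef /Uc /Gj.
have Eb b : b != 0 -> q^-1 * q ^+ 2 / (b / q) = q ^+ 2 / b.
  by move=> b0; field; rewrite b0 q0.
have Eb2 a b : a != 0 -> b != 0 -> q^-1 * q ^+ 2 / (a / q * (b / q)) = q ^+ 3 / (a * b).
  by move=> a0 b0; field; rewrite a0 b0 q0.
by rewrite !Eb // !Eb2.
Qed.

Lemma xH_u : x H = u.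
Proof. by rewrite /oddq half_mE exprSr mulfK // q_neq0. Qed.

Lemma wterm_eq0 dl ep k : (H < k)%N -> wterm dl ep k = 0.
Proof.
move=> hk; rewrite /wterm (bigD1 (Ordinal hk)) //=.
have -> : hf u^-1 H = 0 by rewrite /hf xH_u mulVf ?u_neq0 // subrr mul0r.
by rewrite !(mulr0, mul0r).
Qed.

Lemma sum_wterm dl ep M : (H <= M)%N ->
  \sum_(k < M.+1) wterm dl ep k = \sum_(k < H.+1) wterm dl ep k.
Proof.
move=> hM; have -> : M.+1 = (H.+1 + (M - H))%N by lia.
rewrite sum_ordD [X in _ + X]big1 ?addr0 // => i _.
by rewrite wterm_eq0 // leq_addr.
Qed.

Lemma q_sub_neq0 a b : a != b -> q ^+ a - q ^+ b != 0.
Proof.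
have q0 := q_neq0; wlog ab : a b / (a < b)%N => [hw ne|_].
  case: (ltngtP a b) => h; first by apply: hw.
    by rewrite -oppr_eq0 opprB; apply: hw; rewrite // eq_sym.
  by rewrite h eqxx in ne.
have -> : q ^+ b = q ^+ a * q ^+ (b - a) by rewrite -exprD subnKC // ltnW.
by rewrite -[X in X - _]mulr1 -mulrBr mulf_neq0 ?expf_neq0 // q_neq1 // subn_gt0.
Qed.

Lemma lhs_term_split k : lhs_term k =
  mixed_term w0 u^-1 k + (wterm u 1 k + wterm 1 1 k - wterm u u^-1 k).
Proof.
have u0 := u_neq0.
have Ew i : Xw w0 (x i) / Xw w0 (y i) = hf u i * hf u^-1 i.
  (* The exponent m of u is odd and that of y_i is even. *)
  have n1 : u - y i != 0 by apply: q_sub_neq0; apply/eqP; lia.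
  have n2 : 1 - u * y i != 0 by rewrite -exprD q_neq1 //; lia.
  by rewrite !Xw_w0 /hf; field; rewrite u0 n1 ?n2 mulNr [y i * u]mulrC n2.
have E0 i : Xw 0 (x i) / Xw 0 (y i) = hf 1 i * hf 1 i.
  by rewrite /hf -expr2 expr_div_n /Xw !mulr0 !subr0 mul1r.
have Aw : Af w0 k = \prod_(i < k) (hf u i * hf u^-1 i).
  by apply: eq_bigr => i _.
have A0 : Af 0 k = \prod_(i < k) (hf 1 i * hf 1 i) by apply: eq_bigr => i _.
have E1 w b : (1 - q ^+ (4 * k) / q) * Cf k * (Af w k - Af 0 k) * (Bf b k - Bf 1 k) =
  (1 - q ^+ (4 * k) / q) * (Cf k * Af w k * Bf b k)
  - (1 - q ^+ (4 * k) / q) * (Cf k * Af w k * Bf 1 k)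
  - (1 - q ^+ (4 * k) / q) * (Cf k * Af 0 k * Bf b k)
  + (1 - q ^+ (4 * k) / q) * (Cf k * Af 0 k * Bf 1 k) by ring.
rewrite /mixed_term E1 /lhs_term /wterm.
have -> : \prod_(i < k) gf 1 i = Cf k * Af 0 k * Bf 1 k.
  by rewrite A0 -!big_split; apply: eq_bigr => i _ /=; rewrite /gf; ring.
have -> : \prod_(i < k) (q ^+ 7 * hf 1 i * hf u i * hf 1 i * hf u^-1 i * hf c i * hf d i)
   = Cf k * Af w0 k * Bf 1 k.
  by rewrite Aw -!big_split; apply: eq_bigr => i _ /=; ring.
have -> : \prod_(i < k) (q ^+ 7 * hf 1 i * hf 1 i * hf 1 i * hf u^-1 i * hf c i * hf d i)
   = Cf k * Af 0 k * Bf u^-1 k.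
  by rewrite A0 -!big_split; apply: eq_bigr => i _ /=; ring.
have -> : \prod_(i < k) (q ^+ 7 * hf 1 i * hf u i * hf u^-1 i * hf u^-1 i * hf c i * hf d i)
   = Cf k * Af w0 k * Bf u^-1 k.
  by rewrite Aw -!big_split; apply: eq_bigr => i _ /=; ring.
by ring.
Qed.

Theorem lhs_main M : (H <= M < m)%N ->
  cg I 4 (\sum_(k < M.+1) lhs_term k)
    (\sum_(k < H.-1) Om * (P (q ^+ 3) k ^+ 3 / P (q ^+ 2) k) * Gj k.+2).
Proof.
move=> /andP [hM1 hM2]; have u0 := u_neq0; have h2 := H_ge2.
have hy b i : (b = 1) \/ (b = u) \/ (b = u^-1) -> b - y i != 0.
  move=> [->|[->|->]]; first by apply: q_neq1; lia.
    by apply: q_sub_neq0; apply/eqP; lia.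
  have -> : u^-1 - y i = (1 - u * y i) / u by field.
  by rewrite mulf_neq0 ?invr_eq0 // -exprD q_neq1 //; lia.
have -> : \sum_(k < M.+1) lhs_term k = \sum_(k < M.+1) mixed_term w0 u^-1 k
   + \sum_(j < H.+1) (Uc u 1 j + Uc 1 1 j - Uc u u^-1 j) * Gj j.
  under eq_bigr => k _ do rewrite lhs_term_split.
  rewrite big_split /=; congr (_ + _); rewrite sumrB big_split /= !sum_wterm //.
  rewrite !watson_wterm ?oner_neq0 ?invr_eq0 //; try by move=> i; apply: hy; tauto.
  by rewrite -big_split -sumrB; apply: eq_bigr => j _ /=; ring.
rewrite /cg -addrA; apply: levD.
  by apply: mixed_sum; [exact: lev_w0|exact: cg_uV|rewrite hM1].
(* The terms j = 0 and j = 1 are split off; they have order four and no counterpart on the right. *)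
have -> : H.+1 = (2 + H.-1)%N by lia.
rewrite (sum_ordD (fun j => (Uc u 1 j + Uc 1 1 j - Uc u u^-1 j) * Gj j)) -addrA.
apply: levD.
  apply: (@lev_sum _ _ _ _ (fun j => (Uc u 1 j + Uc 1 1 j - Uc u u^-1 j) * Gj j)) => j hj.
  by apply: levMr; [rewrite Uc_low_A // add0r; apply: Uc_low|apply: lev_Gj; lia].
rewrite -sumrB.
apply: (@lev_sum _ _ _ _ (fun k => (Uc u 1 (2 + k) + Uc 1 1 (2 + k) - Uc u u^-1 (2 + k))
  * Gj (2 + k) - Om * (P (q ^+ 3) k ^+ 3 / P (q ^+ 2) k) * Gj k.+2)) => k hk.
rewrite -mulrBl; apply: levMr; first by apply: Uc_main; lia.
by apply: lev_Gj; lia.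
Qed.

(** * Both sides of the theorem over the local ring *)

Lemma lhs_sideE M : lhs_side q c d M = (1 - q)^-1 * \sum_(k < M.+1) lhs_term k.
Proof.
rewrite mulr_sumr; apply: eq_bigr => k _; have q0 := q_neq0.
have c0 := lunit_neq0 c_unit; have d0 := lunit_neq0 d_unit.
have hc i : c - y i != 0 := lunit_neq0 (c_sub _).
have hd i : d - y i != 0 := lunit_neq0 (d_sub _).
have Eb b : b != 0 -> q^-1 * q ^+ 2 / (b / q) = q ^+ 2 / b.
  by move=> b0; field; rewrite b0 q0.
have Ec := poch_ratio k c0 hc; have Ed := poch_ratio k d0 hd; rewrite !Eb // in Ec Ed.
have E1 : P q^-1 k / P (q ^+ 2) k = \prod_(i < k) hf 1 i.
  rewrite -odd_poch -even_poch -prodf_div.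
  by apply: eq_bigr => i _; rewrite /hf mul1r.
rewrite /lhs_term.
have -> : \prod_(i < k) gf 1 i = q ^+ 7 ^+ k * (\prod_(i < k) hf 1 i) ^+ 4
    * \prod_(i < k) hf c i * \prod_(i < k) hf d i.
  have -> : q ^+ 7 ^+ k = \prod_(i < k) q ^+ 7 by rewrite prodr_const card_ord.
  by rewrite -prodrXl -!big_split; apply: eq_bigr => i _; rewrite /gf /=; ring.
have Ec' : \prod_(i < k) hf c i = P (c / q) k / P (q ^+ 2 / c) k / c ^+ k.
  by rewrite Ec mulrC mulKf // expf_neq0.
have Ed' : \prod_(i < k) hf d i = P (d / q) k / P (q ^+ 2 / d) k / d ^+ k.
  by rewrite Ed mulrC mulKf // expf_neq0.
rewrite -E1 Ec' Ed' (expr_div_n (q ^+ 7)) (expr_div_n (P q^-1 k)) [(c * d) ^+ k]exprMn.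
move: (P q^-1 k) (P (c / q) k) (P (d / q) k) => A1 A2 A3.
move: (P (q ^+ 2) k) (P (q ^+ 2 / c) k) (P (q ^+ 2 / d) k) => A4 A5 A6.
by rewrite !invfM; ring.
Qed.

Lemma one_plus_q_neq0 : 1 + q != 0 /\ 1 + q ^+ 2 != 0.
Proof.
have n2 := q_neq1 (isT : (0 < 2)%N); have n4 := q_neq1 (isT : (0 < 4)%N).
split; [apply: contraNneq n2 => h|apply: contraNneq n4 => h].
  by have -> : 1 - q ^+ 2 = (1 - q) * (1 + q) by [ring|]; rewrite h mulr0.
by have -> : 1 - q ^+ 4 = (1 - q ^+ 2) * (1 + q ^+ 2) by [ring|]; rewrite h mulr0.
Qed.

(** An exact identity: splitting the first two factors off the factorials in [Gj] at k + 2 yields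
    the prefactor and moves the bases to q^6 and q^7. *)
Lemma rhs_sideE : rhs_side q c d m =
  (1 - q)^-1 * \sum_(k < H.-1) Om * (P (q ^+ 3) k ^+ 3 / P (q ^+ 2) k) * Gj k.+2.
Proof.
have q0 := q_neq0; have u0 := u_neq0; have hH := half_mE; have h2 := H_ge2.
have c0 := lunit_neq0 c_unit; have d0 := lunit_neq0 d_unit.
have [n1 n2] := one_plus_q_neq0; have n3 := lunit_neq0 lunit_1q.
have n4 : 1 - u != 0 := q_sub1m_neq0; have n5 := lunit_neq0 lunit_1uq.
have Epred : q ^+ m.-1 = u / q.
  by apply: (canRL (mulfK q0)); rewrite -exprSr prednK // ltnW.
have n6 : q - u != 0.
  have : 1 - q ^+ m.-1 != 0 by apply: q_neq1; lia.
  by rewrite Epred; apply: contraNneq => h; rewrite -(divff q0) -mulrBl h mul0r.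
have EO : Omega_side q m = Om * (1 + q) ^+ 2 * q ^+ 4 /
    ((1 - q) ^+ 3 * ((1 - q ^+ 2) * (1 - q ^+ 4))).
  rewrite /Omega_side /Om /nu Epred (exprSr q m) natrX.
  have -> : q ^+ (m + 5)./2 = q ^+ (H - 2) * q ^+ 4.
    by rewrite -exprD; congr (_ ^+ _); lia.
  have -> : 1 - q ^+ 4 = (1 - q) * (1 + q) * (1 + q ^+ 2) by ring.
  have -> : 1 - q ^+ 2 = (1 - q) * (1 + q) by ring.
  move: u0 n4 n5 n6; move: (u) (q ^+ (H - 2)) => U Q U0 n4 n5 n6.
  have n24 := lunit_neq0 (nat_unit 23).
  by field; rewrite q0 n1 n2 n3 n4 n5 n6 n24.
rewrite /rhs_side !mulr_sumr.
have -> : ((m - 3) %/ 2).+1 = H.-1 by lia.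
apply: eq_bigr => k _; rewrite /Gj -(add2n k) !pochD EO.
have -> : q ^+ 3 / (c * d) * q ^+ 2 ^+ 2 = q ^+ 7 / (c * d) by field; rewrite c0 d0.
have -> : q ^+ 2 * q ^+ 2 ^+ 2 = q ^+ 6 by ring.
have -> : q ^+ 2 / c * q ^+ 2 ^+ 2 = q ^+ 6 / c by field; rewrite c0.
have -> : q ^+ 2 / d * q ^+ 2 ^+ 2 = q ^+ 6 / d by field; rewrite d0.
have -> : P (q ^+ 2) 2 = (1 - q ^+ 2) * (1 - q ^+ 4).
  by rewrite !pochS poch0; ring.
rewrite (exprD (q ^+ 2) 2 k) (exprM q 2 k).
move: (P (q ^+ 3) k) (P (q ^+ 7 / _) k) (P (q ^+ 2) k) (P (q ^+ 6) k) => B1 B2 B3 B4.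
move: (P (q ^+ 6 / c) k) (P (q ^+ 6 / d) k) => B5 B6.
move: (P (q ^+ 3 / _) 2) (P (q ^+ 2 / c) 2) (P (q ^+ 2 / d) 2) => B7 B8 B9.
move: (q_neq1 (isT : (0 < 2)%N)) (q_neq1 (isT : (0 < 4)%N)).
move: (1 - q ^+ 2) (1 - q ^+ 4) (q ^+ 2 ^+ k) => C2 C4 Q m2 m4.
have -> : (1 - q) ^+ 3 = (1 - q) ^+ 2 * (1 - q) by ring.
move: n1 n3; move: (1 + q) (1 - q) => C1 C3 n1 n3.
rewrite !invfM.
have E1 : C1 ^+ 2 * C1^-1 ^+ 2 = 1 by rewrite -exprMn divff // expr1n.
have E3 : C3 ^+ 2 * C3^-1 ^+ 2 = 1 by rewrite -exprMn divff // expr1n.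
transitivity (Om * q ^+ 4 * C2^-1 * C4^-1 * C3^-1 * (C1 ^+ 2 * C1^-1 ^+ 2)
  * (C3 ^+ 2 * C3^-1 ^+ 2) * B7 * B8^-1 * B9^-1 * B1 ^+ 3 * B2 * B3^-1 * B4^-1
  * B5^-1 * B6^-1 * Q); last by rewrite E1 E3; ring.
by ring.
Qed.

Theorem local_main M : (H <= M < m)%N -> cg I 4 (lhs_side q c d M) (rhs_side q c d m).
Proof.
move=> hM; rewrite lhs_sideE rhs_sideE /cg -mulrBr; apply: levMl; last exact: lhs_main.
by case: lunit_1q.
Qed.

Lemma lhs_side_lev n M : (m %| n)%N -> odd n -> M = half n.+1 \/ M = n.-1 ->
  I 1 (lhs_side q c d M).
Proof.
move=> /dvdnP [a ->] on hM; have hH := half_mE; have h2 := H_ge2.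
(* For n = am with a odd, (n+1)/2 + 1 = m(a-1)/2 + H + 1 and n = m(a-1) + m, so the last block is
   cut right after H or is complete. *)
have hl : exists b L, (H < L <= m)%N /\ (M.+1 = m * b + L)%N.
  case: hM => ->.
    exists a./2, H.+1; split; first by have := H_lt; lia.
    have oa : odd a by move: on; rewrite oddM => /andP [].
    have := odd_double_half a; rewrite oa; nia.
  exists a.-1, m; split; first by have := H_lt; rewrite leqnn andbT.
  by case: a on => [|a] //= _; nia.
case: hl => b [L [hL E]]; rewrite lhs_sideE E; apply: levMl; first by case: lunit_1q.
exact: lhs_sum.
Qed.

Lemma poch_b_unit b s k : lunit I b -> (forall j, lunit I (b - q ^+ j)) ->
  lunit I (P (q ^+ s / b) k).
Proof.
move=> hb hj.
apply: (@lunit_prod _ _ _ (fun i => 1 - q ^+ s / b * q ^+ 2 ^+ i)) => i _.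
have -> : 1 - q ^+ s / b * q ^+ 2 ^+ i = (b - q ^+ (s + 2 * i)) / b.
  by rewrite exprD exprM; field; rewrite (lunit_neq0 hb).
by apply: lunitM; [apply: hj|apply: lunitV].
Qed.

Lemma lunit_plus : lunit I (1 + q) /\ lunit I (1 + q ^+ 2).
Proof.
have u1 := lunit_1q; have u2 : lunit I (1 - q ^+ 2).
  by apply: q_sub1; apply/negP => /dvdn_leq -/(_ isT); lia.
have u4 : lunit I (1 - q ^+ 4).
  apply: q_sub1; rewrite (_ : 4 = 2 * 2)%N // Gauss_dvdr ?coprimen2 //.
  by apply/negP => /dvdn_leq -/(_ isT); lia.
have n1 := lunit_neq0 u1; have n2 := lunit_neq0 u2; split.
  have -> : 1 + q = (1 - q ^+ 2) / (1 - q) by field.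
  by apply: lunitM => //; apply: lunitV.
have -> : 1 + q ^+ 2 = (1 - q ^+ 4) / (1 - q ^+ 2) by field.
by apply: lunitM => //; apply: lunitV.
Qed.

Lemma rhs_side_lev n : (m %| n)%N -> (1 < n)%N -> I 1 (rhs_side q c d n).
Proof.
move=> dn hn; have q0 := q_neq0; have u1 := lunit_1q; have [v1 v2] := lunit_plus.
have Oq := lev_q; have O1 := lev1 I.
have ucd : lunit I (c * d) by apply: lunitM.
have OP s k : I 0 (P (q ^+ s / (c * d)) k) by apply: lev_poch; apply: lev_div.
have Uc s k := poch_b_unit s k c_unit c_sub; have Ud s k := poch_b_unit s k d_unit d_sub.
have hO : I 1 (Omega_side q n).
  have nn : 1 - q ^+ n != 0 by apply: q_neq1; apply: ltnW.
  have vp : lunit I (1 - q ^+ n.-1).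
    apply: q_sub1; apply/negP => h; have : (m %| 1)%N; last by rewrite dvdn1; lia.
    by rewrite -(dvdn_addr 1 h) addn1 prednK // ltnW.
  have vs : lunit I (1 - q ^+ n.+1).
    by apply: q_sub1; rewrite -addn1 dvdn_addr // dvdn1; lia.
  have hn1 : I 1 (1 - q ^+ n).
    by case/dvdnP: dn => a ->; rewrite mulnC; apply: cg_sym; apply: cg_qm.
  (* Once [n]^2 is cleared inside the braces, a factor 1 - q^n survives; the denominators 1 -
     q^(n-1) and 1 - q^(n+1) are units. *)
  have -> : Omega_side q n = (1 - q ^+ n) * (((1 - q ^+ n) ^+ 2 *
     (((n ^ 2)%N%:R * (1 - q) ^+ 2 - (1 + 22%:R * q + q ^+ 2)) / 24%:R)
     - (1 - q) ^+ 4 / (q * (1 - q ^+ n.-1) * (1 - q ^+ n.+1)))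
     * q ^+ ((n + 5)./2) / ((1 - q) ^+ 3 * (1 + q ^+ 2))).
    rewrite /Omega_side; move: (n ^ 2)%N => N2.
    move: nn (lunit_neq0 vp) (lunit_neq0 vs) (lunit_neq0 u1) (lunit_neq0 v2).
    move: (1 - q ^+ n) (1 - q ^+ n.-1) (1 - q ^+ n.+1) (q ^+ _./2) => a1 a2 a3 a4.
    move=> m1 m2 m3 m4 m5; have m24 := lunit_neq0 (nat_unit 23).
    by field; rewrite q0 m1 m2 m3 m4 m5 m24.
  apply: levMr => //; apply: lev_div; last by apply: lunitM => //; apply: lunitX.
  have Oq1 := lunit_lev q_unit; have On := lev_w hn1; have O22 := lev_nat I 22.
  have ON := lev_nat I (n ^ 2); apply: levMl; last exact: Oq.
  apply: levB.
    by apply: levMl; [lv|apply: lev_div; [lv|apply: nat_unit]].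
  by apply: lev_div; [lv|do 2 apply: lunitM => //].
apply: levMr.
  apply: lev_div; last first.
    by apply: lunitM => //; apply: lunitM => //; apply: lunitX.
  by apply: levMr => //; apply: levMr => //; lv.
apply: (@lev_sum _ _ _ _ (fun k => P (q ^+ 3) k ^+ 3 * P (q ^+ 7 / (c * d)) k
      / (P (q ^+ 2) k * P (q ^+ 6) k * P (q ^+ 6 / c) k * P (q ^+ 6 / d) k)
      * q ^+ (2 * k))) => k _.
have -> : P (q ^+ 3) k ^+ 3 * P (q ^+ 7 / (c * d)) k
      / (P (q ^+ 2) k * P (q ^+ 6) k * P (q ^+ 6 / c) k * P (q ^+ 6 / d) k)
      * q ^+ (2 * k) = P (q ^+ 3) k ^+ 3 / (P (q ^+ 2) k * P (q ^+ 6) k)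
   * (P (q ^+ 7 / (c * d)) k / (P (q ^+ 6 / c) k * P (q ^+ 6 / d) k) * q ^+ (2 * k)).
  by rewrite !invfM; ring.
apply: levMl; first exact: rhs_term_lev.
by apply: levMl => //; apply: lev_div => //; apply: lunitM.
Qed.

End Cyclotomic.

(** * The local rings of the field of rational functions *)

Local Notation pQtoC := (map_poly (ratr : rat -> algC)).

Definition PhiQ n : {poly rat} := map_poly (fun z : int => z%:~R) 'Phi_n.

Lemma PhiRE n : PhiR n = (PhiQ n)%:P%:P.
Proof.
rewrite /PhiR /qR.
pose f : {rmorphism {poly rat} -> R3} := polyC \o polyC.
have -> : map_poly (fun z : int => z%:~R) 'Phi_n =
    map_poly f (map_poly polyC (PhiQ n)) :> {poly R3}.
  rewrite /PhiQ -!map_poly_comp; apply: eq_map_poly => z /=.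
  by rewrite -[RHS]/((polyC \o polyC \o polyC) (z%:~R : rat)) rmorph_int.
rewrite -[('X)%:P%:P]/(f 'X) horner_map /=; congr (_%:P%:P).
by have := comp_polyXr (PhiQ n); rewrite /comp_poly.
Qed.

Lemma pQtoC_PhiQ n z : n.-primitive_root z -> pQtoC (PhiQ n) = cyclotomic z n.
Proof.
move=> hz; rewrite -(Cintr_Cyclotomic hz) /PhiQ -map_poly_comp.
by apply: eq_map_poly => t /=; rewrite ratr_int.
Qed.

Lemma PhiQ_min n z (p : {poly rat}) : n.-primitive_root z ->
  root (pQtoC p) z = (PhiQ n %| p).
Proof.
move=> hz; have [p0 [E _] h] := minCpolyP z.
rewrite h; congr (_ %| _); apply: (map_inj_poly (fmorph_inj (ratr : {rmorphism rat -> algC})));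
  first exact: rmorph0.
by rewrite -E (minCpoly_cyclotomic hz) -pQtoC_PhiQ.
Qed.

Section Evaluation.
Variable z : algC.

Definition ev0 : {poly rat} -> algC := horner_eval z \o pQtoC.
HB.instance Definition _ := GRing.RMorphism.on ev0.

(** Only q is specialised, to a root of unity below; c and d stay indeterminate, so c - q^j and d -
    q^j never evaluate to 0. *)
Definition ev : R3 -> {poly {poly algC}} := map_poly (map_poly ev0).
HB.instance Definition _ := GRing.RMorphism.on ev.

Lemma evCC p : ev p%:P%:P = (ev0 p)%:P%:P.
Proof. by rewrite /ev map_polyC /= map_polyC. Qed.

Lemma ev_q : ev qR = z%:P%:P.
Proof.
by rewrite /qR evCC /ev0 /= map_polyX /horner_eval hornerX.
Qed.

Lemma ev_c : ev cR = ('X)%:P.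
Proof. by rewrite /ev /cR map_polyC /= map_polyX. Qed.

Lemma ev_d : ev dR = 'X.
Proof. by rewrite /ev /dR map_polyX. Qed.

Variable n : nat.
Hypothesis hz : n.-primitive_root z.

Lemma ev_Phi m : (ev (PhiR m) == 0) = root (pQtoC (PhiQ m)) z.
Proof. by rewrite PhiRE evCC !polyC_eq0. Qed.

(** Every coefficient of N is a polynomial in q vanishing at z, hence a multiple of the minimal
    polynomial Phi_n; the quotient is formed coefficientwise. *)
Lemma ev_eq0 (N : R3) : ev N = 0 -> exists N', N = PhiR n * N'.
Proof.
move=> h; exists (map_poly (map_poly (fun r => r %/ PhiQ n)) N).
rewrite PhiRE; apply/polyP => i; rewrite coefCM coef_map_id0 ?map_poly0 //.
apply/polyP => j; rewrite coefCM coef_map_id0 ?div0p //.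
rewrite mulrC divpK // -(PhiQ_min _ hz).
have := congr1 (fun p : {poly {poly algC}} => p`_i`_j) h.
by rewrite /ev !coef_map /= coef0 coef0 => /eqP.
Qed.

(** The e-th power of the maximal ideal in the localisation of Q[q,c,d] at Phi_n: [ev D != 0] means
    that Phi_n does not divide D. *)
Definition local_lev e (x : F3) :=
  exists N D : R3, ev D != 0 /\ x = toF (PhiR n ^+ e * N) / toF D.

Lemma ev_neq0 (D : R3) : ev D != 0 -> toF D != 0.
Proof.
by rewrite /toF tofrac_eq0; apply: contraNneq => ->; rewrite rmorph0.
Qed.

Lemma evPhi0 : ev (PhiR n) = 0.
Proof.
apply/eqP; rewrite ev_Phi (pQtoC_PhiQ hz) root_cyclotomic //.
Qed.

Lemma local_lev0 e : local_lev e 0.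
Proof.
by exists 0, 1; rewrite rmorph1 oner_neq0 mulr0 /toF tofrac0 mul0r.
Qed.

Lemma local_lev1 : local_lev 0 1.
Proof.
by exists 1, 1; rewrite rmorph1 oner_neq0 mulr1 expr0 /toF tofrac1 divr1.
Qed.

Lemma local_levD e x y : local_lev e x -> local_lev e y -> local_lev e (x + y).
Proof.
move=> [N1 [D1 [h1 ->]]] [N2 [D2 [h2 ->]]].
exists (N1 * D2 + N2 * D1), (D1 * D2); rewrite rmorphM mulf_neq0 //; split=> //.
rewrite addf_div ?ev_neq0 // /toF -!tofracM -tofracD; congr (tofrac _ / _); ring.
Qed.

Lemma local_levN e x : local_lev e x -> local_lev e (- x).
Proof.
move=> [N [D [h ->]]]; exists (- N), D; split=> //.
by rewrite mulrN /toF tofracN mulNr.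
Qed.

Lemma local_levM e f x y : local_lev e x -> local_lev f y -> local_lev (e + f) (x * y).
Proof.
move=> [N1 [D1 [h1 ->]]] [N2 [D2 [h2 ->]]].
exists (N1 * N2), (D1 * D2); rewrite rmorphM mulf_neq0 //; split=> //.
by rewrite mulf_div /toF -!tofracM exprD mulrACA.
Qed.

Lemma local_lev_leq e f x : (e <= f)%N -> local_lev f x -> local_lev e x.
Proof.
move=> ef [N [D [h ->]]]; exists (PhiR n ^+ (f - e) * N), D; split=> //.
by rewrite mulrA -exprD subnKC.
Qed.

Lemma local_lev_local x : local_lev 1 (x - 1) -> x != 0 /\ local_lev 0 x^-1.
Proof.
move=> [N [D [h E]]]; have D0 := ev_neq0 h.
have hN : ev (D + PhiR n * N) != 0.
  by rewrite rmorphD rmorphM /= evPhi0 mul0r addr0.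
have Ex : x = toF (D + PhiR n * N) / toF D.
  by rewrite -(subrK 1 x) E expr1 /toF tofracD mulrDl divff // addrC.
have N0 := ev_neq0 hN; split.
  by rewrite Ex; apply: mulf_neq0; [exact: N0|rewrite invr_eq0; exact: D0].
exists D, (D + PhiR n * N); split; first exact: hN.
by rewrite Ex invf_div expr0 mul1r.
Qed.

Definition local_filtration : filtration F3 :=
  Filtration local_lev0 local_lev1 local_levD local_levN local_levM local_lev_leq
    local_lev_local.

Lemma lunit_toF (a : R3) : ev a != 0 -> lunit local_filtration (toF a).
Proof.
move=> ha; split; first exact: ev_neq0.
- by exists a, 1; rewrite rmorph1 oner_neq0 expr0 mul1r /toF tofrac1 divr1.
- by exists 1, a; split=> //; rewrite mulr1 expr0 /toF tofrac1 mul1r.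
Qed.

Lemma lev_toF (a : R3) : ev a = 0 -> local_filtration 1 (toF a).
Proof.
move=> /ev_eq0 [N ->]; exists N, 1.
by rewrite rmorph1 oner_neq0 expr1 /toF tofrac1 divr1.
Qed.

Lemma toF_expq j : toF (qR ^+ j) = q ^+ j. Proof. exact: tofracXn. Qed.

Lemma z_neq0 : z != 0. Proof.
apply/eqP => z0; have := prim_expr_order hz.
by rewrite z0 expr0n eqn0Ngt (prim_order_gt0 hz) /= => /eqP; rewrite eq_sym oner_eq0.
Qed.

Lemma local_q : lunit local_filtration q.
Proof. by apply: lunit_toF; rewrite ev_q !polyC_eq0 z_neq0. Qed.

Lemma local_c : lunit local_filtration c.
Proof. by apply: lunit_toF; rewrite ev_c polyC_eq0 polyX_eq0. Qed.

Lemma local_d : lunit local_filtration d.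
Proof. by apply: lunit_toF; rewrite ev_d polyX_eq0. Qed.

Lemma local_qm1 : cg local_filtration 1 (q ^+ n) 1.
Proof.
rewrite /cg -toF_expq -[X in _ - X]tofrac1 -tofracB; apply: lev_toF.
by rewrite rmorphB rmorphXn rmorph1 /= ev_q -!rmorphXn /= (prim_expr_order hz) subrr.
Qed.

Lemma local_q_sub1 j : ~~ (n %| j)%N -> lunit local_filtration (1 - q ^+ j).
Proof.
move=> hj; rewrite -toF_expq -[X in X - _]tofrac1 -tofracB; apply: lunit_toF.
rewrite rmorphB rmorphXn rmorph1 /= ev_q -!rmorphXn /= -!polyC1 -!rmorphB /=.
by rewrite !polyC_eq0 subr_eq0 eq_sym -(prim_order_dvd hz).
Qed.

Lemma local_c_sub j : lunit local_filtration (c - q ^+ j).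
Proof.
rewrite -toF_expq -tofracB; apply: lunit_toF.
by rewrite rmorphB rmorphXn /= ev_q ev_c -!rmorphXn /= -rmorphB /= polyC_eq0 polyXsubC_eq0.
Qed.

Lemma local_d_sub j : lunit local_filtration (d - q ^+ j).
Proof.
rewrite -toF_expq -tofracB; apply: lunit_toF.
by rewrite rmorphB rmorphXn /= ev_q ev_d -!rmorphXn /= polyXsubC_eq0.
Qed.

Lemma local_nat k : lunit local_filtration k.+1%:R.
Proof.
have -> : k.+1%:R = toF k.+1%:R :> F3 by rewrite /toF rmorph_nat.
apply: lunit_toF; rewrite rmorph_nat.
have -> : k.+1%:R = (k.+1%:R)%:P%:P :> {poly {poly algC}} by rewrite !rmorph_nat.
by rewrite !polyC_eq0 pnatr_eq0.
Qed.
End Evaluation.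

(** * From local to global *)

Lemma q_sub1_neq0 j : (0 < j)%N -> 1 - q ^+ j != 0.
Proof.
move=> j0; rewrite -toF_expq -[X in X - _]tofrac1 -tofracB /toF tofrac_eq0.
rewrite -rmorphXn /= -rmorphXn /= -!polyC1 -!rmorphB /= !polyC_eq0.
by rewrite -opprB oppr_eq0 -size_poly_eq0 size_XnsubC.
Qed.

Lemma primitive_root_uniq m t (z : algC) :
  m.-primitive_root z -> t.-primitive_root z -> m = t.
Proof.
move=> hm ht; apply/eqP; rewrite eqn_dvd.
by rewrite (prim_order_dvd hm) (prim_order_dvd ht) !prim_expr_order ?eqxx.
Qed.

Lemma ev_Phi_neq0 m t (z z' : algC) : m.-primitive_root z -> t.-primitive_root z' ->
  m != t -> ev z (PhiR t) != 0.
Proof.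
move=> hm ht ne; rewrite ev_Phi (pQtoC_PhiQ ht) root_cyclotomic //.
by apply: contraNN ne => /(primitive_root_uniq hm) ->.
Qed.

(* With x = P N1 / D1 and x = Phi^e N2 / D2, the fraction
   P Phi^e (N1 + N2) / (D1 Phi^e + D2 P) also represents x, and its denominator
   is nonzero at the roots of P (where the second summand vanishes) and of Phi. *)
Lemma glue_local (x : F3) (e : nat -> nat) (zt : nat -> algC) m0 s :
    uniq (m0 :: s) -> {in m0 :: s, forall m, m.-primitive_root (zt m)} ->
    {in m0 :: s, forall m, (0 < e m)%N} ->
    {in m0 :: s, forall m, local_lev (zt m) m (e m) x} ->
  exists N D : R3, x = toF (\prod_(m <- m0 :: s) PhiR m ^+ e m * N) / toF D /\
    {in m0 :: s, forall m, ev (zt m) D != 0}.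
Proof.
elim: s m0 => [|m1 s IH] m us hz he hx.
  have [N [D [hD E]]] := hx m (mem_head _ _).
  exists N, D; split; first by rewrite big_seq1.
  by move=> t; rewrite inE => /eqP ->.
have sub : {subset m1 :: s <= m :: m1 :: s} by move=> t ht; rewrite inE ht orbT.
have {IH} [|||| N1 [D1 [E1 h1]]] := IH m1.
- by case/andP: us.
- by move=> t /sub; apply: hz.
- by move=> t /sub; apply: he.
- by move=> t /sub; apply: hx.
have [N2 [D2 [h2 E2]]] := hx m (mem_head _ _).
have hm := hz _ (mem_head m _); have em := he _ (mem_head m _).
have notin : m \notin m1 :: s by case/andP: us.
rewrite big_cons; move: E1; set Ps := \prod_(m <- m1 :: s) _ => E1.
have evP t : t \in m1 :: s -> ev (zt t) Ps = 0.
  move=> ht; rewrite /Ps (big_rem t ht) /= rmorphM rmorphXn /= evPhi0 ?expr0n //.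
    by rewrite eqn0Ngt (he _ (sub _ ht)) mul0r.
  exact: hz (sub _ ht).
have evPm : ev (zt m) Ps != 0.
  rewrite /Ps rmorph_prod /= prodf_seq_neq0; apply/allP => t ht /=.
  rewrite rmorphXn; apply: expf_neq0.
  apply: (ev_Phi_neq0 hm (hz _ (sub _ ht))).
  by apply: contraNneq notin => ->.
have D1n : toF D1 != 0 by apply: (ev_neq0 (h1 _ (mem_head m1 s))).
have D2n : toF D2 != 0 by apply: (ev_neq0 h2).
exists (N1 + N2), (D1 * PhiR m ^+ e m + D2 * Ps).
have hev : {in m :: m1 :: s, forall t, ev (zt t) (D1 * PhiR m ^+ e m + D2 * Ps) != 0}.
  move=> t; rewrite inE => /orP [/eqP ->|ht]; rewrite rmorphD !rmorphM rmorphXn /=.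
    by rewrite (evPhi0 hm) expr0n eqn0Ngt em mulr0 add0r; apply: mulf_neq0.
  rewrite (evP _ ht) mulr0 addr0; apply: mulf_neq0; first exact: h1.
  apply/expf_neq0/(ev_Phi_neq0 (hz _ (sub _ ht)) hm).
  by apply: contraNneq notin => <-.
split; last exact: hev.
have Dn := ev_neq0 (hev _ (mem_head m _)).
have F1 : x * toF D1 = toF (Ps * N1) by rewrite E1 (divfK D1n).
have F2 : x * toF D2 = toF (PhiR m ^+ e m * N2) by rewrite {1}E2 (divfK D2n).
apply: (canRL (mulfK Dn)).
rewrite {1}/toF tofracD !tofracM -/(toF D1) -/(toF D2) mulrDr !mulrA F1 F2.
by rewrite /toF -!tofracM -tofracD; congr tofrac; ring.
Qed.

Lemma PhiR_prod n : (0 < n)%N -> \prod_(m <- divisors n) PhiR m = qR ^+ n - 1.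
Proof.
move=> n0; under eq_bigr => m _ do rewrite PhiRE.
rewrite -rmorph_prod -rmorph_prod /=.
have -> : \prod_(m <- divisors n) PhiQ m = 'X^n - 1.
  rewrite -rmorph_prod prod_Cyclotomic // rmorphB rmorphXn rmorph1 /= map_polyX.
  by [].
by rewrite rmorphB rmorphXn rmorph1 /= rmorphB rmorphXn rmorph1.
Qed.

Lemma qR_sub1_neq0 : qR - 1 != 0.
Proof.
by rewrite /qR -!polyC1 -!rmorphB /= !polyC_eq0 polyXsubC_eq0.
Qed.

Lemma qintR_prod n : (1 < n)%N ->
  qintR n = \prod_(m <- [seq m <- divisors n | m != 1%N]) PhiR m.
Proof.
move=> n1; have n0 := ltnW n1.
have E1 : PhiR 1 = qR - 1.
  by have := PhiR_prod (ltn0Sn 0); rewrite (_ : divisors 1 = [:: 1%N]) // big_seq1 expr1.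
apply: (mulfI qR_sub1_neq0); rewrite /qintR -subrX1 -PhiR_prod //.
rewrite (big_rem 1%N) /=; last by rewrite -dvdn_divisors // dvd1n.
by rewrite E1 rem_filter ?divisors_uniq.
Qed.

(** Phi_n already occurs once in [n], whence the exponent 4. *)
Lemma modulus_prod n : (1 < n)%N ->
  qintR n * PhiR n ^+ 3 =
  \prod_(m <- [seq m <- divisors n | m != 1%N]) PhiR m ^+ (if m == n then 4 else 1).
Proof.
move=> n1; rewrite qintR_prod //.
have hn : n \in [seq m <- divisors n | m != 1%N].
  by rewrite mem_filter divisors_id ?(ltnW n1) // andbT; lia.
rewrite !(big_rem n hn) /= eqxx mulrAC -exprS; congr (_ * _).
rewrite !big_seq; apply: eq_bigr => m; rewrite mem_rem_uniq ?filter_uniq ?divisors_uniq //.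
by rewrite inE => /andP [/negPf ->]; rewrite expr1.
Qed.

Lemma rdiv_polyC (R : idomainType) (g k : {poly R}) (a : R) :
  a != 0 -> a%:P = g * k -> exists g0 k0, [/\ g = g0%:P, k = k0%:P & a = g0 * k0].
Proof.
move=> a0 E; have := congr1 (size \o polyseq) E; rewrite /= size_polyC a0 => Es.
have gk : g * k != 0 by rewrite -E polyC_eq0.
have [g0 k0] : g != 0 /\ k != 0 by move: gk; rewrite mulf_eq0 negb_or => /andP.
have sg : (0 < size g)%N by rewrite size_poly_gt0.
have sk : (0 < size k)%N by rewrite size_poly_gt0.
rewrite size_mul // in Es.
have Eg : g = (g`_0)%:P by apply: size1_polyC; lia.
have Ek : k = (k`_0)%:P by apply: size1_polyC; lia.
exists g`_0, k`_0; split=> //; apply: polyC_inj.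
by rewrite E rmorphM /= -Eg -Ek.
Qed.

(** A divisor g of the modulus is a polynomial in q alone. If it is not constant, it has a complex
    root, a primitive m-th root of unity for some m in s. By minimality Phi_m divides g, so g
    vanishes at the chosen root [zt m] too, and hence so does D. *)
Lemma coprime_modulus (e : nat -> nat) (zt : nat -> algC) s (D g : R3) :
    {in s, forall m, m.-primitive_root (zt m)} -> {in s, forall m, ev (zt m) D != 0} ->
    rdiv g D -> rdiv g (\prod_(m <- s) PhiR m ^+ e m) -> g \is a GRing.unit.
Proof.
move=> hz hD [k1 E1] [k E].
pose P0 := \prod_(m <- s) PhiQ m ^+ e m.
have P0n : P0 != 0.
  rewrite prodf_seq_neq0; apply/allP => m _ /=; rewrite expf_neq0 // monic_neq0 //.
  by rewrite monic_map // Cyclotomic_monic.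
have EP : \prod_(m <- s) PhiR m ^+ e m = P0%:P%:P.
  rewrite /P0 !rmorph_prod /=; apply: eq_bigr => m _.
  by rewrite PhiRE !rmorphXn.
rewrite EP in E.
have [|g1 [k2 [Eg _ E2]]] := rdiv_polyC _ E; first by rewrite polyC_eq0.
have [g0 [k3 [Eg1 _ E3]]] := rdiv_polyC P0n E2.
rewrite {}Eg1 in Eg; rewrite Eg.
have g0n : g0 != 0 by apply: contraNneq P0n => h; rewrite E3 h mul0r.
suff : size g0 == 1%N.
  move=> /size_poly1P [a a0 ->]; do 3 apply: rmorph_unit.
  by rewrite unitfE.
case: (size g0 =P 1%N) => // sg.
have : size (pQtoC g0) != 1%N by rewrite size_map_poly; apply/eqP.
move=> /closed_rootP [z rz].
have : root (pQtoC P0) z by rewrite E3 rmorphM rootM rz.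
rewrite /P0 rmorph_prod /= rootE horner_prod prodf_seq_eq0 => /hasP [m ms] /=.
rewrite rmorphXn -rootE /= => rm.
have {rm} rm : root (pQtoC (PhiQ m)) z.
  by move: rm; rewrite !rootE horner_exp expf_eq0 => /andP [].
have hm := hz _ ms.
have zm : m.-primitive_root z.
  by move: rm; rewrite (pQtoC_PhiQ hm) root_cyclotomic.
have : root (pQtoC g0) (zt m) by rewrite (PhiQ_min _ hm) -(PhiQ_min _ zm).
move=> /rootP r0; case/eqP: (hD _ ms).
by rewrite E1 Eg rmorphM /= evCC /ev0 /= /horner_eval r0 !rmorph0 mul0r.
Qed.

Lemma qint_pred k : qint ((4 * k)%N%:Z - 1) = (1 - q ^+ (4 * k) / q) / (1 - q).
Proof.
have q0 : q != 0.
  by rewrite /q /toF tofrac_eq0 /qR !polyC_eq0 polyX_eq0.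
by rewrite /qint expfzDr.
Qed.

Lemma lhs12E M : lhs12 M = lhs_side q c d M.
Proof.
rewrite /lhs12 big_mkord; apply: eq_bigr => k _.
by rewrite qint_pred.
Qed.

Lemma rhs12E n : rhs12 n = rhs_side q c d n.
Proof. by rewrite /rhs12 big_mkord. Qed.

Theorem theorem1p2 (n M : nat) :
  (1 < n)%N -> odd n -> M = half n.+1 \/ M = n.-1 ->
  congr_mod (lhs12 M) (rhs12 n) (qintR n * PhiR n ^+ 3).
Proof.
move=> n1 on hM.
(* The guard 0 < m only serves to make the choice of roots a total function. *)
have hzt m : {z : algC | (0 < m)%N -> m.-primitive_root z}.
  case: m => [|m]; first by exists 0.
  by have [z hz] := C_prim_root_exists (ltn0Sn m); exists z.
pose zt m := sval (hzt m); pose e (m : nat) : nat := if m == n then 4%N else 1%N.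
pose s := [seq m <- divisors n | m != 1%N].
have hn : n \in s by rewrite mem_filter divisors_id ?(ltnW n1) // andbT; lia.
have hs m : m \in s -> [/\ (m %| n)%N, (1 < m)%N, odd m & m.-primitive_root (zt m)].
  rewrite mem_filter -dvdn_divisors ?(ltnW n1) // => /andP [m1 dm].
  have m0 : (0 < m)%N by apply: dvdn_gt0 dm; apply: ltnW.
  split=> //; first by lia.
  - by apply: dvdn_odd dm on.
  - exact: (svalP (hzt m)).
have hl m : m \in s -> local_lev (zt m) m (e m) (lhs12 M - rhs12 n).
  move=> /hs [dm m1 om hz]; rewrite lhs12E rhs12E /e.
  case: (m =P n) => [En|_].
    rewrite En in m1 om hz *.
    apply: (local_main m1 om (local_q hz) (local_c hz) (local_d hz) (local_qm1 hz)
      (local_q_sub1 hz) (local_c_sub hz) (local_d_sub hz) (local_nat hz) q_sub1_neq0).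
    by case: hM => ->; lia.
  apply: (@levB _ (local_filtration hz)).
    exact: (lhs_side_lev m1 om (local_q hz) (local_c hz) (local_d hz) (local_qm1 hz)
      (local_q_sub1 hz) (local_c_sub hz) (local_d_sub hz) (local_nat hz) q_sub1_neq0 dm on hM).
  exact: (rhs_side_lev m1 om (local_q hz) (local_c hz) (local_d hz) (local_qm1 hz)
      (local_q_sub1 hz) (local_c_sub hz) (local_d_sub hz) (local_nat hz) q_sub1_neq0 dm n1).
rewrite modulus_prod // -/s.
have us : uniq s by rewrite filter_uniq ?divisors_uniq.
case Es : s hn => [|m0 s'] // _.
have [N [D [EN hD]]] : exists N D : R3, lhs12 M - rhs12 n =
    toF (\prod_(m <- m0 :: s') PhiR m ^+ e m * N) / toF D /\
    {in m0 :: s', forall m, ev (zt m) D != 0}.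
  apply: glue_local; rewrite -Es //.
  - by move=> m /hs [].
  - by move=> m _; rewrite /e; case: ifP.
exists (\prod_(m <- m0 :: s') PhiR m ^+ e m * N), D; split.
  by apply: contraNneq (hD _ (mem_head m0 s')) => ->; rewrite rmorph0.
split; first exact: EN.
split; first by exists N.
move=> g g1 g2; apply: (coprime_modulus (e := e) _ hD g1 g2).
by move=> m; rewrite -Es => /hs [].
Qed.
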